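(* Let $b\ge2$ be an integer. For any $p\ge1$, with all objects below attached to the word $w=0^p$ (the word made of $p$ zeros), there holds $$I(b,0^p,0)=\sum_{a=1}^{b-1}\frac1a+\sum_{m=0}^\infty(-1)^m\Bigl(\sum_{a=b}^{b^2-1}A_{m+1}(a)\int_{[0,1)}B_m(x)\,d\mu_0(x)-\sum_{a=1}^{b-1}A_{m+1}(ab^p)\,\mathfrak R_{m+1}(b,0^p)\Bigr),$$ with a geometrically convergent series (with general term indexed by $m$ as displayed).
   Context: Words and occurrences. Words are finite sequences (possibly empty) of digits in $\Sigma_b=\{0,\dots,b-1\}$; leading zeros are allowed. For a word $g$, $|g|$ is its length, $n(g)$ is the non-negative integer it represents in base $b$ (most significant digit on the left, $n(\text{empty})=0$), $x(g)=n(g)/b^{|g|}\in[0,1)$, and $\phi_g(t)=x(g)+b^{-|g|}t$. For a non-empty word $w$, $k_w(g)$ is the number of (possibly overlapping) occurrences of $w$ as a contiguous block in $g$. $I(b,w,0)$ is the sum of $1/n$ over all positive integers $n$ whose base-$b$ representation (without leading zeros) contains no occurrence of $w$. Languages attached to $w$: $\mathcal F$ is the set of words $g$ with $k_w(g)=0$ (including the empty word); $\mathcal R$ is the set of words $g$ (including the empty word) with $k_w(wg)=1$; $\mathcal G$ is the set of words $g$ such that $wg$ contains exactly two occurrences of $w$, the second one being terminal (a suffix of $wg$). Measures on $[0,1)$: $\mu_0=\sum_{g\in\mathcal F}b^{-|g|}\delta_{x(g)}$ and $\eta_0=\sum_{g\in\mathcal R}b^{-|g|}\delta_{x(g)}$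 (both of finite total mass). For $j\ge1$, $\lambda_j(w)=\sum_{g\in\mathcal G}b^{-j|g|}$; one has $\lambda_1(w)=1$. $\nu_j$ is the unique Borel probability measure on $[0,1]$ with $\sum_{g\in\mathcal G}b^{-j|g|}(\phi_g)_*\nu_j=\lambda_j(w)\nu_j$ (so $\nu_1$ is Lebesgue measure). For $m\ge0$, $B_m$ is the unique monic polynomial of degree $m$ with $\mathsf K_wB_m=\lambda_{m+1}(w)B_m$, where $(\mathsf K_wf)(x)=\sum_{g\in\mathcal G}b^{-|g|}f(\phi_g(x))$. For integers $j\ge1$, $n\ge1$: $A_j(n)=\int_0^1(n+x)^{-j}\,d\nu_j(x)$, and $\mathfrak R_j(b,w)=\int_{[0,1)}B_{j-1}(x)\,d\eta_0(x)$. A series is geometrically convergent if its $m$-th term is $O(\theta^m)$ for some $0<\theta<1$. *)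

(* Defs.v *)
From HB Require Import structures.
From mathcomp Require Import all_boot all_order all_algebra.
From mathcomp Require Import all_classical all_reals all_analysis.

Set Implicit Arguments.
Unset Strict Implicit.
Unset Printing Implicit Defensive.
Import Order.TTheory GRing.Theory Num.Theory.
Import numFieldNormedType.Exports.

Local Open Scope classical_set_scope.
Local Open Scope ring_scope.

Section words.
Variable b : nat.

Definition word := seq 'I_b.
Implicit Types (w g : word).

Definition word_val g : nat := foldl (fun n (d : 'I_b) => n * b + d)%N 0%N g.

(* Meaningful for non-empty [w]; occurrences may overlap. *)
Definition occ w g : nat :=
  count (fun i => prefix w (drop i g)) (iota 0 (size g)).

(* The empty word represents 0. *)
Definition base_repr g (n : nat) : Prop :=
  word_val g = n /\ (if g is d :: _ then (0 < d)%N else true).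

Definition langF w : set word := [set g | occ w g = 0%N].

Definition langR w : set word := [set g | occ w (w ++ g) = 1%N].

Definition langG w : set word :=
  [set g | occ w (w ++ g) = 2%N /\ suffix w (w ++ g)].

End words.

Definition zeros (b : nat) (hb : (1 < b)%N) (p : nat) : word b :=
  nseq p (Ordinal (ltnW hb)).

Section objects.
Variables (R : realType) (b : nat).
Implicit Types (w g : word b).

Definition word_pt g : R := (word_val g)%:R / b%:R ^+ size g.

Definition phi g (t : R) : R := word_pt g + b%:R ^- size g * t.

(* [base_repr g n] determines [g], so each [n] is counted once. *)
Definition kempner w : \bar R :=
  \esum_(n in [set n : nat | (0 < n)%N /\
                 exists2 g : word b, base_repr g n & occ w g = 0%N])
    (n%:R^-1)%:E.

Definition word_measure (D : set (word b)) (A : set (measurableTypeR R))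
    : \bar R :=
  (\esum_(g in D) ((b%:R ^- size g)%:E * \d_(word_pt g : measurableTypeR R) A))%E.

Section word_measure_is_measure.
Variable D : set (word b).
Local Open Scope ereal_scope.

Let word_weight_ge0 g : 0 <= (b%:R ^- size g)%:E :> \bar R.
Proof. by rewrite lee_fin invr_ge0 exprn_ge0. Qed.

Let word_measure0 : word_measure D set0 = 0.
Proof. by rewrite /word_measure esum1// => g _; rewrite measure0 mule0. Qed.

Let word_measure_ge0 A : 0 <= word_measure D A.
Proof. by apply: esum_ge0 => g _; rewrite mule_ge0. Qed.

Let word_measure_sigma_additive : semi_sigma_additive (word_measure D).
Proof.
move=> F mF tF mUF.
have -> : word_measure D (\bigcup_n F n) = \sum_(0 <= i <oo) word_measure D (F i).
  rewrite nneseries_esumT; last by move=> n; exact: word_measure_ge0.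
  rewrite /word_measure esum_esum; last by move=> *; rewrite mule_ge0.
  transitivity (\esum_(g in D) \esum_(i in [set: nat])
      ((b%:R ^- size g)%:E * \d_(word_pt g : measurableTypeR R) (F i)
         : \bar R)).
    apply: eq_esum => g _.
    rewrite measure_semi_bigcup// -nneseriesZl//.
    by rewrite nneseries_esumT// => n; rewrite mule_ge0.
  rewrite esum_esum; last by move=> *; rewrite mule_ge0.
  rewrite (reindex_esum [set z | True /\ D z.2] _ (fun z => (z.2, z.1)))//=.
  split=> /=.
  - by move=> [i g] [].
  - by move=> [i g] [i' g'] _ _ [-> ->].
  - by move=> [g i] [Dg _]; exists (i, g).
by apply: is_cvg_ereal_nneg_natsum => n _; exact: word_measure_ge0.
Qed.

HB.instance Definition _ := isMeasure.Build _ (measurableTypeR R) R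
  (word_measure D) word_measure0 word_measure_ge0 word_measure_sigma_additive.

End word_measure_is_measure.

Definition mu0 w : {measure set (measurableTypeR R) -> \bar R} :=
  word_measure (langF w).

Definition eta0 w : {measure set (measurableTypeR R) -> \bar R} :=
  word_measure (langR w).

Definition lambda w (j : nat) : \bar R :=
  \esum_(g in langG w) (b%:R ^- (j * size g))%:E.

(* [nu] is a Borel probability measure on the real line, carried by [0, 1]. *)
Definition is_nu w (j : nat) (nu : probability (measurableTypeR R) R) : Prop :=
  nu `[0, 1]%classic = 1%E /\
  forall A : set (measurableTypeR R), measurable A ->
    (\esum_(g in langG w)
       ((b%:R ^- (j * size g))%:E *
          pushforward nu (phi g : measurableTypeR R -> measurableTypeR R) A)
     = lambda w j * nu A)%E.

(* The terms are signed: the sum over the language is that of the positive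
   parts minus that of the negative parts. *)
Definition opK w (f : R -> R) (x : R) : \bar R :=
  let s g := (b%:R ^- size g * f (phi g x))%:E in
  (\esum_(g in langG w) s^\+ g - \esum_(g in langG w) s^\- g)%E.

Definition is_B w (m : nat) (B : {poly R}) : Prop :=
  [/\ B \is monic, size B = m.+1 &
      forall x, x \in `[0, 1] ->
        opK w (horner B) x = (lambda w m.+1 * (B.[x])%:E)%E].

Definition coefA (nu : nat -> probability (measurableTypeR R) R) (j n : nat)
    : R :=
  \int[nu j]_(x in `[0, 1]) (n%:R + x) ^- j.

Definition coefR w (B : nat -> {poly R}) (j : nat) : R :=
  \int[eta0 w]_(x in `[0, 1[) (B j.-1).[x].

End objects.

Definition geometric_series (R : realType) (u : R^nat) : Prop :=
  exists theta : R, [/\ 0 < theta, theta < 1 &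
    u =O_\oo (fun m => theta ^+ m : R^o)].

(* Main.v *)
From HB Require Import structures.
Require Import Defs.
From mathcomp Require Import all_boot all_order all_algebra.
From mathcomp Require Import all_classical all_reals all_analysis.
From mathcomp Require Import measurable_realfun.
From mathcomp Require Import ring lra zify.

Set Implicit Arguments.
Unset Strict Implicit.
Unset Printing Implicit Defensive.
Import Order.TTheory GRing.Theory Num.Theory.
Import numFieldNormedType.Exports.

Local Open Scope classical_set_scope.
Local Open Scope ring_scope.

                                       

(** Cut the integers that avoid $0^p$ after their first two digits. Those with one digit give $\sum
    1/a$. Every other one is $b^{|g|}(a+x(g))$ with $b\le a<b^2$, and summing over all tails
    $g\in\mathcal F$ would give $\int d\mu_0(x)/(a+x)$. This counts too much exactly when the second
    digit is 0 and $g=0^{p-1}h$ with $h\in\mathcal R$. For the leading digit $d$ these extra terms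
    are $b^{-|h|}/(db^p+x(h))$, with total $\int d\eta_0(x)/(db^p+x)$ ([digit_tail_split],
    [kempner_digit_tail]).

    It remains to expand $1/(n+x)=\sum_m(-1)^mA_{m+1}(n)B_m(x)$, uniformly on $[0,1]$ and at a
    geometric rate for $n\ge2$ ([resolvent_expansion]). The functionals $q\mapsto\int
    q^{(i)}/i!\,d\nu_{i+1}$ are eigenvectors of the transpose of $\mathsf K_w$ for $\lambda_{i+1}$,
    because $i$ derivatives of $f\circ\phi_g$ bring out $b^{-i|g|}$. Hence they are biorthogonal to
    the $B_m$, and every polynomial expands exactly ([dualB_orthogonal], [dualB_expansion]). On
    $1/(n+x)$ the $i$-th functional is $(-1)^iA_{i+1}(n)$. To stay within polynomials, $1/(n+x)$ is
    replaced by a partial sum of its geometric series about $1/2$, with the errors of all Taylor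
    coefficients under control ([resolvent_errP], [sum_resolvent_err]).

    The errors can be summed because $|B_m|\le C(3/2)^m$ on $[0,1]$ ([eigenpoly_bounded]). The
    eigenvalue equation is triangular in the coefficients of $B_m$. The word $0\in\mathcal G$ forces
    $\lambda_{i+1}-\lambda_{m+1}\ge b^{-(i+1)}(1-1/b)$ ([gmom_gap]). Every word of $\mathcal G$ ends
    in 0, so the off-diagonal entries carry the same factor $b^{-(i+1)}$ ([gmom_growth]). A discrete
    Gronwall inequality ([growth_of_tails]) then bounds the coefficients. Since
    $|A_{m+1}(n)|\le2^{-m}$, the general term is $O((3/4)^m)$. *)

(** * Sums over sets of non-negative terms *)

Lemma esum_finType (R : realType) (T : finType) (P : pred T) (F : T -> \bar R) :
  (forall x, P x -> 0 <= F x)%E ->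
  (\esum_(x in [set x | P x]) F x = \sum_(x | P x) F x)%E.
Proof.
move=> F0; rewrite esum_fset//; [|exact: finite_finset|by move=> x /set_mem/F0].
have -> : [set x | P x] = [set` enum P] by apply/seteqP; split=> x /=; rewrite mem_enum.
by rewrite -fsbig_seq ?enum_uniq// big_enum.
Qed.

Lemma le_esum_subset (R : realType) (T : choiceType) (D E : set T)
    (f : T -> \bar R) :
  D `<=` E -> (forall x, 0 <= f x)%E ->
  (\esum_(x in D) f x <= \esum_(x in E) f x)%E.
Proof.
move=> DE f0; rewrite esum_mkcond [leRHS]esum_mkcond; apply: le_esum => x _.
case: ifPn => [/set_mem/DE/mem_set->//|_]; by case: ifP.
Qed.

Lemma esumZl_fin (R : realType) (T : choiceType) (D : set T) (a : R) (f : T -> R) :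
  0 <= a -> (forall g, 0 <= f g) ->
  (\esum_(g in D) (a * f g)%:E = a%:E * \esum_(g in D) (f g)%:E)%E.
Proof.
move=> a_ge0 f0.
have le_mul (x : R) (h : T -> R) : 0 <= x -> (forall g, 0 <= h g) ->
    (\esum_(g in D) (x * h g)%:E <= x%:E * \esum_(g in D) (h g)%:E)%E.
  move=> x0 h0; apply: ge_ereal_sup => _ [X [finX XD] <-].
  under eq_fsbigr do rewrite EFinM.
  rewrite -ge0_mule_fsumr; last by move=> g; rewrite lee_fin.
  by rewrite lee_wpmul2l ?lee_fin// ereal_sup_ubound//; exists X.
move: a_ge0; rewrite le_eqVlt => /predU1P[<-|a_gt0].
  by rewrite mul0e esum1// => g _; rewrite mul0r.
apply/eqP; rewrite eq_le le_mul ?(ltW a_gt0)//=.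
rewrite -lee_pdivlMl//.
apply: (le_trans _ (le_mul _ _ _ _)); last 2 first.
- by rewrite invr_ge0 ltW.
- by move=> g; rewrite mulr_ge0// ltW.
by rewrite le_eqVlt; apply/orP; left; apply/eqP/eq_esum => g _; rewrite mulKf ?gt_eqF.
Qed.

(** Evaluates [opK] on a polynomial, where the terms are signed combinations of the non-negative
    families coming from the monomials. *)
Lemma esum_pos_neg_linear (R : realType) (T : choiceType) (D : set T) (n : nat)
    (a : nat -> R) (f : nat -> T -> R) :
  (forall k g, 0 <= f k g) ->
  (forall k, (\esum_(g in D) (f k g)%:E < +oo)%E) ->
  let s g := (\sum_(0 <= k < n) a k * f k g)%:E in
  (\esum_(g in D) s^\+ g - \esum_(g in D) s^\- g =
   (\sum_(0 <= k < n) a k * fine (\esum_(g in D) (f k g)%:E))%:E)%E.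
Proof.
move=> f0 foo s.
have sum_fin (c : nat -> R) : (forall k, 0 <= c k) ->
    (\esum_(g in D) (\sum_(0 <= k < n) c k * f k g)%:E =
     (\sum_(0 <= k < n) c k * fine (\esum_(g in D) (f k g)%:E))%:E)%E.
  move=> c0; under eq_esum do rewrite -sumEFin.
  rewrite esum_sum; last by move=> g k _ _; rewrite lee_fin mulr_ge0.
  rewrite -sumEFin; apply: eq_bigr => k _; rewrite esumZl_fin// EFinM fineK//.
  by rewrite ge0_fin_numE// esum_ge0// => g _; rewrite lee_fin.
(* [p] and [q] collect the positive and the negative coefficients. They need not be the positive and
   negative parts of [s], but both are summable and their difference is [s]. *)
pose p g := (\sum_(0 <= k < n) Num.max (a k) 0 * f k g)%:E.
pose q g := (\sum_(0 <= k < n) Num.max (- a k) 0 * f k g)%:E.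
have p0 g : (0 <= p g)%E.
  by rewrite lee_fin sumr_ge0// => k _; rewrite mulr_ge0// le_max lexx orbT.
have q0 g : (0 <= q g)%E.
  by rewrite lee_fin sumr_ge0// => k _; rewrite mulr_ge0// le_max lexx orbT.
have maxB (x : R) : Num.max x 0 - Num.max (- x) 0 = x.
  case: (lerP 0 x) => x0; first by rewrite (max_idPr _) ?oppr_le0// subr0.
  by rewrite (max_idPl _) ?oppr_ge0 ?ltW// sub0r opprK.
have sE : s = (p \- q)%E.
  apply/funext => g; rewrite /s /p /q -EFinB -sumrB; congr _%:E.
  by apply: eq_bigr => k _; rewrite -mulrBl maxB.
rewrite sE esumB//; last 2 first.
- rewrite /summable (eq_esum (fun g _ => gee0_abs (p0 g))) sum_fin ?ltry//.
  by move=> k; rewrite le_max lexx orbT.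
- rewrite /summable (eq_esum (fun g _ => gee0_abs (q0 g))) sum_fin ?ltry//.
  by move=> k; rewrite le_max lexx orbT.
rewrite !sum_fin; [|by move=> k; rewrite le_max lexx orbT..].
by rewrite -EFinB -sumrB; congr _%:E; apply: eq_bigr => k _; rewrite -mulrBl maxB.
Qed.

                               

(** * Occurrences of a word and the sparsity of the words that avoid it *)

Section words.
Variable b : nat.
Implicit Types (d : 'I_b) (w g h : word b).

Lemma occ_cons w d g : occ w (d :: g) = (prefix w (d :: g) + occ w g)%N.
Proof. by rewrite /occ /= (iotaDl 1 0) count_map. Qed.

Lemma occ_short w g : (size g < size w)%N -> occ w g = 0%N.
Proof.
elim: g => [//|d g IH] /= gw; rewrite occ_cons IH ?(ltn_trans _ gw)// addn0.
by case: prefixP gw => // -[s /(congr1 size)/=->]; rewrite size_cat ltnNge leq_addr.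
Qed.

Lemma occ_prefix w g : w != [::] -> prefix w g -> (0 < occ w g)%N.
Proof.
case: g => [|d g]; first by rewrite prefixs0 => /negbTE->.
by move=> _ wg; rewrite occ_cons wg.
Qed.

Lemma occ_catl w h g : (occ w g <= occ w (h ++ g))%N.
Proof. by elim: h => [|d h IH] //=; rewrite occ_cons (leq_trans IH)// leq_addl. Qed.

Lemma suffix_consE w d g :
  suffix w (d :: g) = (w == d :: g) || suffix w g.
Proof.
apply/idP/idP.
  move=> /suffixP[[|e s]] /=; first by move=> ->; rewrite eqxx.
  by case=> _ ->; rewrite suffix_suffix orbT.
by move=> /orP[/eqP->|/suffix_trans->//]; rewrite ?suffix_refl ?suffix_cons.
Qed.

(** An occurrence that ends at the added letter cannot be one of those already inside [g]. *)
Lemma occ_rcons w g d : w != [::] ->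
  (occ w g + suffix w (rcons g d) <= occ w (rcons g d))%N.
Proof.
move=> w0; elim: g => [|e g IH].
  rewrite /= occ_cons addn0 suffix_consE suffixs0 (negbTE w0) orbF.
  by case: eqP => // ->; rewrite prefix_refl.
rewrite rcons_cons !occ_cons suffix_consE.
have pp : prefix w (e :: g) -> prefix w (e :: rcons g d).
  by move=> /prefix_trans; apply; rewrite -rcons_cons prefix_rcons.
case: (eqVneq w) => [we|_]; rewrite ?orTb ?orFb.
  have -> : prefix w (e :: rcons g d) by rewrite we prefix_refl.
  have /negbTE-> : ~~ prefix w (e :: g).
    by rewrite we; apply/negP => /size_prefix; rewrite /= size_rcons ltnn.
  by move: IH; lia.
by move: IH pp; case: (prefix _ (_ :: g)); case: prefix => //=; lia.
Qed.

Definition avoiders w (l : nat) : {set l.-tuple 'I_b} :=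
  [set t : l.-tuple 'I_b | occ w t == 0%N].

(** Cut such a word after [size w] letters: the head differs from [w], and the tail again avoids
    [w]. *)
Lemma card_avoiders w l : w != [::] ->
  (#|avoiders w (size w + l)| <= (b ^ size w).-1 * #|avoiders w l|)%N.
Proof.
move=> w0; set p := size w.
have tk (t : (p + l).-tuple 'I_b) : size (take p t) == p.
  by rewrite size_takel// size_tuple leq_addr.
have dr (t : (p + l).-tuple 'I_b) : size (drop p t) == l.
  by rewrite size_drop size_tuple addKn.
pose f t : p.-tuple 'I_b * l.-tuple 'I_b := (Tuple (tk t), Tuple (dr t)).
have finj : injective f.
  move=> t1 t2 [tk12 dr12]; apply: val_inj => /=.
  by rewrite -(cat_take_drop p t1) tk12 dr12 cat_take_drop.
rewrite -(card_imset _ finj).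
have -> : (b ^ p).-1 = #|[set~ in_tuple w]%SET|.
  by rewrite cardsC1 card_tuple card_ord.
rewrite -cardsX; apply/subset_leq_card/fintype.subsetP => _ /imsetP[t + ->].
rewrite !inE /= => /eqP t0; apply/andP; split.
  apply: contra_eqN t0 => /eqP/(congr1 val)/= tw.
  by rewrite -(cat_take_drop p t) tw -lt0n occ_prefix// prefix_prefix.
by rewrite -leqn0 -t0 -{2}(cat_take_drop p t) occ_catl.
Qed.

Variable R : realType.

(** Let $s_l$ be the proportion of words of length $l$ that avoid $w$. Then
    $s_{p+l}\le(1-b^{-p})s_l$, so a partial sum $S$ satisfies $S\le\sum_{l<p}s_l+(1-b^{-p})S$, that
    is $S\le b^p\sum_{l<p}s_l$. *)
Lemma word_pow_esum_lty w : (1 < b)%N -> w != [::] ->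
  (\esum_(g in langF w) (b%:R ^- size g : R)%:E < +oo)%E.
Proof.
move=> b1 w0; set p := size w.
have b0 : (0 : R) < b%:R by rewrite ltr0n (ltn_trans _ b1).
pose s l : R := #|avoiders w l|%:R * b%:R ^- l.
have s0 l : 0 <= s l by rewrite mulr_ge0 ?invr_ge0 ?exprn_ge0 ?ler0n.
have sS l : s (p + l)%N <= (1 - b%:R ^- p) * s l.
  have bp : (b ^ p)%:R = b%:R ^+ p :> R by rewrite natrX.
  have -> : 1 - b%:R ^- p = (b ^ p).-1%:R / b%:R ^+ p :> R.
    rewrite -subn1 natrB ?expn_gt0 ?(ltn_trans _ b1)// bp mulrBl divff ?div1r//.
    by rewrite expf_neq0// gt_eqF.
  rewrite /s exprD invfM mulrACA ler_wpM2r ?mulr_ge0 ?invr_ge0 ?exprn_ge0 ?ler0n//.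
  by rewrite -natrM ler_nat card_avoiders.
pose C := b%:R ^+ p * \sum_(0 <= l < p) s l.
have sC n : \sum_(0 <= l < n) s l <= C.
  have Sle : \sum_(0 <= l < n) s l <= \sum_(0 <= l < p + n) s l.
    by rewrite (@big_cat_nat _ _ _ n 0 (p + n)%N) ?leq_addl//= lerDl sumr_ge0.
  have : \sum_(0 <= l < n) s l <=
      \sum_(0 <= l < p) s l + (1 - b%:R ^- p) * \sum_(0 <= l < n) s l.
    apply: (le_trans Sle).
    rewrite (@big_cat_nat _ _ _ p 0 (p + n)%N) ?leq_addr//= lerD2l.
    rewrite -{1}[p]add0n big_addn addKn mulr_sumr ler_sum// => l _.
    by rewrite addnC.
  rewrite mulrBl mul1r addrCA -lerBlDl subrr subr_ge0.
  by rewrite ler_pdivrMl ?exprn_gt0.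
apply: (@le_lt_trans _ _ C%:E); last exact: ltry.
pose J l := [set g | langF w g /\ size g = l].
have -> : langF w = \bigcup_(l in setT) J l.
  by apply/seteqP; split=> [g gw|g [l _ []]//]; exists (size g).
rewrite esum_bigcupT; last 2 first.
- by move=> i j _ _ [g [[_ <-] [_ <-]]].
- by move=> g; rewrite lee_fin invr_ge0 exprn_ge0// ltW.
rewrite -nneseries_esumT; last first.
  by move=> l; apply: esum_ge0 => g; rewrite lee_fin invr_ge0 exprn_ge0// ltW.
have JE l : (\esum_(g in J l) (b%:R ^- size g : R)%:E = (s l)%:E)%E.
  rewrite (reindex_esum [set` avoiders w l] _ val); last first.
    split.
    - move=> t /=; rewrite inE => /eqP ?; split=> //; exact: size_tuple.
    - by move=> t1 t2 _ _; exact: val_inj.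
    - move=> g [gw /eqP gl]; exists (Tuple gl) => //=.
      by rewrite inE /=; apply/eqP.
  rewrite (@esum_finType _ _ (mem (avoiders w l))); last first.
    by move=> t _; rewrite lee_fin invr_ge0 exprn_ge0// ltW.
  under eq_bigr do rewrite size_tuple.
  by rewrite /s mulr_natl -sumr_const -sumEFin.
apply: lime_le.
  by apply: is_cvg_ereal_nneg_natsum => l _; rewrite JE lee_fin.
apply: nearW => n; under eq_bigr do rewrite JE.
by rewrite sumEFin lee_fin.
Qed.

End words.

(** * The three languages attached to $0^p$ *)

Section zeros.
Variables (b : nat) (hb : (1 < b)%N) (p : nat).
Hypothesis hp : (1 <= p)%N.
Let z : 'I_b := Ordinal (ltnW hb).
Let w := zeros hb p.
Implicit Types (d : 'I_b) (g h : word b).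

Lemma size_zeros : size w = p. Proof. exact: size_nseq. Qed.

Lemma zeros_neq0 : w != [::].
Proof. by rewrite -size_eq0 size_zeros -lt0n. Qed.

Lemma zeros_cons : w = z :: zeros hb p.-1.
Proof. by rewrite /w /zeros -{1}(prednK hp). Qed.

Lemma prefix_zeros_cons d g :
  prefix w (d :: g) = (val d == 0%N) && prefix (zeros hb p.-1) g.
Proof. by rewrite zeros_cons /= eq_sym -val_eqE. Qed.

Lemma occ_zeros_cat g : occ w (w ++ g) = (occ w (zeros hb p.-1 ++ g)).+1.
Proof.
by rewrite {2}zeros_cons occ_cons prefix_zeros_cons eqxx prefix_prefix.
Qed.

(** The initial [w] of [w ++ g] is one occurrence; all others lie in what is left after the first
    zero, namely $0^{p-1}g$. *)
Lemma langRE g : langR w g <-> langF w (zeros hb p.-1 ++ g).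
Proof. by rewrite /langR /langF /= occ_zeros_cat; split=> [[]|->]. Qed.

Lemma langR_sub : langR w `<=` langF w.
Proof.
move=> g /langRE; rewrite /langF /= => g0.
by apply/eqP; rewrite -leqn0 -g0 occ_catl.
Qed.

(** The word $0^{p+1}$ contains $0^p$ exactly twice. This single word produces the spectral gap. *)
Lemma langG_zero : langG w [:: z].
Proof.
have wz : w ++ [:: z] = z :: w.
  by rewrite /w /zeros -[[:: z]]/(nseq 1 z) -nseqD addn1.
split; last by rewrite wz suffix_cons.
rewrite wz occ_cons prefix_zeros_cons /=.
have := occ_zeros_cat [::]; rewrite cats0 => ->.
rewrite occ_short ?size_cat ?size_nseq ?addn0 ?prednK//.
rewrite (_ : prefix _ _ = true)//; apply/prefixP; exists [:: z].
by rewrite /w /zeros -[[:: z]]/(nseq 1 z) -nseqD addn1 prednK.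
Qed.

(** The terminal occurrence of $0^p$ ends in a zero. Removing that zero destroys the occurrence, so
    [w ++ h] keeps only its initial one. *)
Lemma langG_rcons g : langG w g -> exists2 h, g = rcons h z & langF w h.
Proof.
case; case/lastP: g => [|h d].
  rewrite cats0; have := occ_zeros_cat [::]; rewrite cats0 => ->.
  by rewrite occ_short // size_cat !size_nseq addn0 prednK.
move=> occ2 sf.
have dz : d = z.
  move: sf; rewrite -rcons_cat /w /zeros -(prednK hp) -addn1 nseqD cats1.
  by rewrite suffix_rcons => /andP[/eqP].
exists h; rewrite ?dz//.
have := @occ_rcons _ w (w ++ h) d zeros_neq0.
rewrite rcons_cat occ2 sf addn1 occ_zeros_cat !ltnS leqn0 => /eqP h0.
by apply/eqP; rewrite -leqn0 -h0 occ_catl.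
Qed.

End zeros.

                                              

(** * Biorthogonality and exact expansion of polynomials *)

Lemma mul_bin_bin k i r : (r + i <= k)%N ->
  ('C(k, r + i) * 'C(r + i, i) = 'C(k, i) * 'C(k - i, r))%N.
Proof.
move=> rik; have ik : (i <= k)%N by rewrite (leq_trans _ rik)// leq_addl.
have rki : (r <= k - i)%N by lia.
have f_gt0 : (0 < i`! * r`! * (k - (r + i))`!)%N by rewrite !muln_gt0 !fact_gt0.
apply/eqP; rewrite -(eqn_pmul2r f_gt0); apply/eqP.
have := bin_fact rik; have := @bin_fact (r + i) i (leq_addl _ _).
have := bin_fact ik; have := bin_fact rki.
rewrite addnK subnDA [(k - r - i)%N]subnAC.
move=> e1 e2 e3 e4.
transitivity k`!; first by rewrite -e4 -e3; ring.
by rewrite -e2 -e1; ring.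
Qed.

Section eigenpolynomials.
Variables (R : realType) (M mom : nat -> nat -> R) (lam : nat -> R).
Variable B : nat -> {poly R}.
Implicit Types (q : {poly R}) (i j k l m N : nat).

Hypothesis B_monic : forall m, B m \is monic.
Hypothesis size_B : forall m, size (B m) = m.+1.
Hypothesis B_eigen : forall m i, (i <= m)%N ->
  \sum_(i <= k < m.+1) 'C(k, i)%:R * M i (k - i) * (B m)`_k = lam m * (B m)`_i.
Hypothesis mom_eigen : forall j k,
  \sum_(0 <= i < k.+1) 'C(k, i)%:R * M (i + j) (k - i) * mom j i = lam j * mom j k.
Hypothesis mom0 : forall j, mom j 0%N = 1.

                                                                               
(** When [mom i] is the moment sequence of $\nu_{i+1}$, this is $\int q^{(i)}/i!\,d\nu_{i+1}$. *)
Definition dualB i q : R := \sum_(0 <= k < size q) 'C(k, i)%:R * q`_k * mom i (k - i).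

Lemma dualBE i q N : (size q <= N)%N ->
  dualB i q = \sum_(0 <= k < N) 'C(k, i)%:R * q`_k * mom i (k - i).
Proof.
move=> qN; rewrite (@big_cat_nat _ _ _ (size q))//= [X in _ + X]big1_seq ?addr0//.
move=> k; rewrite mem_index_iota => /andP[_ /andP[qk _]].
by rewrite nth_default// mulr0 mul0r.
Qed.

Lemma dualB_linear i c q1 q2 : dualB i (q1 - c *: q2) = dualB i q1 - c * dualB i q2.
Proof.
pose N := maxn (size q1) (size q2).
rewrite !(@dualBE _ _ N) ?leq_maxl ?leq_maxr//; last first.
  rewrite (leq_trans (size_polyD _ _))// size_polyN geq_max leq_maxl.
  by rewrite (leq_trans (size_scale_leq _ _))// leq_maxr.
rewrite mulr_sumr -sumrB; apply: eq_bigr => k _.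
by rewrite coefB coefZ; ring.
Qed.

(** Apply the functional to $\mathsf K_wB_m$ in two ways: it is a left eigenvector for [lam i],
    while $B_m$ is a right eigenvector for [lam m]. *)
Lemma dualB_orthogonal i m : (i < m)%N -> lam i != lam m -> dualB i (B m) = 0.
Proof.
move=> im lam_im; apply/eqP; suff: (lam i - lam m) * dualB i (B m) == 0.
  by rewrite mulf_eq0 subr_eq0 (negbTE lam_im).
rewrite mulrBl subr_eq0; apply/eqP.
rewrite (@dualBE _ _ m.+1) ?size_B// !mulr_sumr.
(* The terms of the functional on $\mathsf K_wB_m$: [k] is the degree in $B_m$ and [l] the degree in
   the image. Summing over [l] first, with [l = r + i], gives [lam i] through [mom_eigen]. *)
pose T k l := 'C(k, l)%:R * 'C(l, i)%:R * M l (k - l) * mom i (l - i) * (B m)`_k.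
transitivity (\sum_(0 <= k < m.+1) \sum_(0 <= l < m.+1 | (l < k.+1)%N) T k l).
  apply: eq_big_nat => k /= km.
  rewrite -(@big_nat_widen _ _ _ 0 k.+1 m.+1 xpredT)//.
  case: (leqP i k) => ik; last first.
    rewrite bin_small// !mul0r mulr0 big1_seq// => l.
    rewrite mem_index_iota => /andP[_ lk].
    by rewrite /T (@bin_small l i) ?mulr0 ?mul0r//; lia.
  rewrite (@big_cat_nat _ _ _ i)//=; last by rewrite ltnW.
  rewrite big1_seq ?add0r; last first.
    move=> l; rewrite mem_index_iota => /andP[_ li].
    by rewrite /T (@bin_small l i) ?mulr0 ?mul0r//; lia.
  have -> : \sum_(i <= l < k.+1) T k l = \sum_(0 <= r < (k - i).+1) T k (r + i)%N.
    by rewrite -{1}[i]add0n big_addn subSn.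
  rewrite mulrCA -mom_eigen mulr_sumr.
  apply: eq_big_nat => r /= rk; rewrite /T addnK subnDA subnAC.
  have -> : 'C(k, r + i)%:R * 'C(r + i, i)%:R = 'C(k, i)%:R * 'C(k - i, r)%:R :> R.
    by rewrite -!natrM mul_bin_bin//; lia.
  by ring.
(* Summing over [k] first yields the coefficient [l] of $\mathsf K_wB_m$, whence [lam m] through
   [B_eigen]. *)
rewrite (exchange_big_dep_nat xpredT)//=; apply: eq_big_nat => l /= lm.
have -> : lam m * ('C(l, i)%:R * (B m)`_l * mom i (l - i)) =
  'C(l, i)%:R * mom i (l - i) * (lam m * (B m)`_l) by ring.
rewrite -B_eigen ?mulr_sumr; last by lia.
rewrite (@big_nat_widenl _ _ _ l 0)//=; apply: eq_big => [k|k _].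
  by rewrite ltnS.
by rewrite /T; ring.
Qed.

(** On polynomials of degree at most $N$ the $N$-th functional reads the top coefficient.
    Subtracting that multiple of $B_N$ lowers the degree and, by orthogonality, leaves the earlier
    functionals unchanged. *)
Lemma dualB_expansion N q : (size q <= N)%N ->
    (forall i m, (i < m)%N -> lam i != lam m) ->
  q = \sum_(0 <= m < N) dualB m q *: B m.
Proof.
move=> + lam_neq; elim: N q => [|N IH] q qN.
  by rewrite big_geq//; apply/eqP; rewrite -size_poly_leq0.
pose q' := q - q`_N *: B N.
have BN : (B N)`_N = 1 by move: (B_monic N); rewrite monicE /lead_coef size_B => /eqP.
have q'N : (size q' <= N)%N.
  apply/leq_sizeP => j; rewrite leq_eqVlt => /predU1P[<-|Nj].
    by rewrite coefB coefZ BN mulr1 subrr.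
  rewrite coefB coefZ [q`_j]nth_default ?(leq_trans qN)//.
    by rewrite [_`_j]nth_default ?size_B// mulr0 subr0.
have dN : dualB N q = q`_N.
  rewrite (dualBE _ qN) big_nat_recr//= binn subnn mom0 mul1r mulr1.
  rewrite big1_seq ?add0r// => k; rewrite mem_index_iota => /andP[_ kN].
  by rewrite bin_small// !mul0r.
rewrite big_nat_recr//= dN -[LHS](subrK (q`_N *: B N)) -/q' {1}(IH _ q'N).
congr (_ + _); apply: eq_big_nat => m /= mN.
by rewrite dualB_linear dualB_orthogonal ?lam_neq// mulr0 subr0.
Qed.

End eigenpolynomials.

                                                       
                                                                               
(** * Growth of the eigenpolynomials *)

(** A discrete Gronwall inequality: adding the term [a i] multiplies the tail sum by at most
    $1+H\theta^i\le\exp(H\theta^i)$, and the exponents add up to at most $H/(1-\theta)$. *)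
Lemma growth_of_tails (R : realType) (a : nat -> R) (H theta : R) m :
  0 <= H -> 0 < theta < 1 -> (forall i, 0 <= a i) ->
  (forall i, (i < m)%N -> a i <= H * theta ^+ i * \sum_(i.+1 <= k < m.+1) a k) ->
  \sum_(0 <= k < m.+1) a k <= expR (H / (1 - theta)) * a m.
Proof.
move=> H0 /andP[t0 t1] a0 a_le.
have tail j : (j <= m)%N -> \sum_(0 <= k < m.+1) a k <=
    expR (H * \sum_(0 <= i < j) theta ^+ i) * \sum_(j <= k < m.+1) a k.
  elim: j => [_|j IH jm].
    by rewrite [X in H * X]big_geq// mulr0 expR0 mul1r.
  rewrite (le_trans (IH (ltnW jm)))//.
  rewrite [X in _ <= expR (H * X) * _]big_nat_recr//= mulrDr expRD -mulrA.
  rewrite ler_wpM2l ?expR_ge0// big_ltn ?ltnS ?(ltnW jm)//.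
  rewrite (le_trans (lerD (a_le _ jm) (lexx _)))//.
  rewrite -[X in _ + X <= _]mul1r -mulrDl ler_wpM2r ?sumr_ge0//.
  by rewrite addrC expR_ge1Dx.
rewrite (le_trans (tail m (leqnn _)))// big_nat1 ler_wpM2r// ler_expR ler_wpM2l//.
have -> : \sum_(0 <= i < m) theta ^+ i = (1 - theta ^+ m) / (1 - theta).
  rewrite -[1 - theta ^+ m]opprB subrX1 -mulNr opprB big_mkord mulrAC divff ?mul1r//.
  by rewrite subr_eq0 gt_eqF.
rewrite ler_pdivrMr ?subr_gt0// mulVf ?subr_eq0 ?gt_eqF// lerBlDr lerDl.
by rewrite exprn_ge0// ltW.
Qed.

(** The equation for the coefficient [i] expresses $(\lambda_{i+1}-\lambda_{m+1})B_i$ through higher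
    coefficients. Dividing by the gap and weighting by $\rho^i$ gives the hypothesis of
    [growth_of_tails] with $\theta=\sigma/\rho$; the leading term is $\rho^m$ because $B$ is
    monic. *)
Lemma eigenpoly_growth (R : realType) (M : nat -> nat -> R) (lam gap : nat -> R)
    (B : {poly R}) (m : nat) (H rho sigma : R) :
  0 <= H -> 0 < sigma < rho ->
  B \is monic -> size B = m.+1 ->
  (forall i, (i < m)%N -> 0 < gap i <= lam i - lam m) ->
  (forall i, M i 0%N = lam i) -> (forall i k, 0 <= M i k) ->
  (forall i, (i < m)%N ->
     \sum_(i <= k < m.+1) 'C(k, i)%:R * M i (k - i)%N * B`_k = lam m * B`_i) ->
  (forall i k, (i < k)%N ->
     'C(k, i)%:R * M i (k - i)%N * rho ^+ i <= gap i * H * sigma ^+ k) ->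
  \sum_(0 <= k < m.+1) `|B`_k| * rho ^+ k <= expR (H / (1 - sigma / rho)) * rho ^+ m.
Proof.
move=> H0 /andP[s0 srho] Bmonic sizeB gapP M0 M_ge0 eigen M_le.
have rho0 : 0 < rho by exact: lt_trans srho.
have Bm : B`_m = 1 by move: Bmonic; rewrite monicE /lead_coef sizeB => /eqP.
have := @growth_of_tails R (fun k => `|B`_k| * rho ^+ k) H (sigma / rho) m H0.
rewrite divr_gt0//= ltr_pdivrMr// mul1r Bm normr1 mul1r; apply=> //.
  by move=> i; rewrite mulr_ge0// exprn_ge0// ltW.
move=> i im; have /andP[g0 gle] := gapP _ im.
have g_le : gap i * `|B`_i| <=
    \sum_(i.+1 <= k < m.+1) 'C(k, i)%:R * M i (k - i)%N * `|B`_k|.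
  have := eigen _ im; rewrite big_ltn ?binn ?subnn ?M0 ?mul1r; last by rewrite ltnS ltnW.
  move=> e; have {}e : (lam i - lam m) * B`_i =
      - \sum_(i.+1 <= k < m.+1) 'C(k, i)%:R * M i (k - i)%N * B`_k.
    by rewrite mulrBl -e opprD addrA subrr sub0r.
  rewrite (@le_trans _ _ `|(lam i - lam m) * B`_i|)//.
    by rewrite normrM ler_wpM2r// (le_trans gle)// ler_norm.
  rewrite e normrN (le_trans (ler_norm_sum _ _ _))//; apply: ler_sum => k _.
  by rewrite !normrM normr_nat (ger0_norm (M_ge0 _ _)).
rewrite -(ler_pM2l g0) mulrA.
rewrite (le_trans (ler_wpM2r _ g_le)) ?exprn_ge0 ?(ltW rho0)//.
rewrite mulr_suml !mulrA mulr_sumr; apply: ler_sum_nat => k /andP[ik km].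
rewrite mulrAC (le_trans (ler_wpM2r _ (M_le _ _ ik)))//.
rewrite [_ * rho ^+ k]mulrC [X in _ <= X]mulrA ler_wpM2r// -[X in _ <= X]mulrA.
rewrite ler_wpM2l ?mulr_ge0 ?(ltW g0)//.
have -> : sigma ^+ k = (sigma / rho) ^+ k * rho ^+ k.
  by rewrite -exprMn divfK// gt_eqF.
rewrite ler_wpM2r ?exprn_ge0 ?(ltW rho0)//.
(* Since $\sigma/\rho<1$, the exponent [k] may be lowered to [i], which makes the factor independent
   of [k]. *)
apply: ler_wiXn2l; rewrite ?divr_ge0 ?(ltW s0) ?(ltW rho0)//; last exact: ltnW.
by rewrite ler_pdivrMr// mul1r ltW.
Qed.

Lemma norm_horner_le (R : realType) (B : {poly R}) (m : nat) (x rho : R) :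
  size B = m.+1 -> 0 <= x <= 1 -> 1 <= rho ->
  `|B.[x]| <= \sum_(0 <= k < m.+1) `|B`_k| * rho ^+ k.
Proof.
move=> sizeB /andP[x0 x1] rho1.
rewrite horner_coef sizeB big_mkord (le_trans (ler_norm_sum _ _ _))//.
apply: ler_sum => k _; rewrite normrM normrX (ger0_norm x0).
by rewrite ler_wpM2l// lerXn2r ?nnegrE// ?(le_trans x1) // (le_trans ler01).
Qed.

                                              

(** * Polynomial approximation of $1/(n+x)$ with all its Taylor coefficients *)

Lemma coef_affine_exp (R : comNzRingType) (a d : R) N m :
  ((a%:P + d *: 'X) ^+ N)`_m = 'C(N, m)%:R * a ^+ (N - m) * d ^+ m.
Proof.
rewrite exprDn coef_sum.
have cE (l : nat) : (a%:P ^+ (N - l) * (d *: 'X) ^+ l *+ 'C(N, l))`_m =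
    'C(N, l)%:R * a ^+ (N - l) * d ^+ l *+ (m == l).
  rewrite exprZn -scalerAr coefMn coefZ -polyC_exp coefCM coefXn -mulr_natl.
  by case: (m == l); rewrite ?mulr1n ?mulr0n /=; ring.
under eq_bigr do rewrite cE.
case: (ltnP m N.+1) => mN.
  rewrite (bigD1 (Ordinal mN))//= eqxx big1 ?addr0// => l lm.
  rewrite (_ : (m == l) = false)//; apply: contraNF lm => /eqP ml.
  exact/eqP/val_inj.
rewrite bin_small// !mul0r big1// => l _.
by rewrite (_ : (m == l) = false)//; have := ltn_ord l; lia.
Qed.

Section resolvent.
Variables (R : realType) (n : R).
Hypothesis n_gt0 : 0 < n.
Implicit Types (x rho : R) (m N : nat).

Let c := n + 2^-1.

Let c_gt0 : 0 < c. Proof. by rewrite addr_gt0 ?invr_gt0. Qed.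

                                                                             
                                                      
(** Partial sum of the geometric series of $1/(c+(x-1/2))$, where $c=n+1/2$. Centring at the
    midpoint makes the error rate $(1/2+\rho)/c$, which is $4/5$ for $n=2$ and $\rho=3/2$; about 0
    it would be $(1+\rho)/n=5/4$. *)
Definition resolvent_poly N : {poly R} :=
  c^-1 *: \sum_(k < N) (- c^-1 *: ('X - (2^-1)%:P)) ^+ k.

Lemma size_resolvent_poly N : (size (resolvent_poly N) <= N)%N.
Proof.
rewrite (leq_trans (size_scale_leq _ _))// (leq_trans (size_sum _ _ _))//.
apply/bigmax_leqP => k _; rewrite exprZn (leq_trans (size_scale_leq _ _))//.
by rewrite size_exp_XsubC.
Qed.

Lemma resolvent_polyM N :
  (n%:P + 'X) * resolvent_poly N = 1 - (- c^-1 *: ('X - (2^-1)%:P)) ^+ N.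
Proof.
set Z := - c^-1 *: _.
have -> : n%:P + 'X = c *: (1 - Z).
  rewrite scalerBr /Z scalerA mulrN divff ?gt_eqF// scaleN1r opprK.
  by rewrite alg_polyC /c polyCD; ring.
rewrite /resolvent_poly -/Z -scalerAl -scalerAr scalerA divff ?gt_eqF// scale1r.
by rewrite -[1 - Z]opprB -[1 - Z ^+ N]opprB subrX1 mulNr.
Qed.

(** This is $q^{(m)}(x)/m!$. *)
Definition taylor_coef (q : {poly R}) x m := (q \Po ('X + x%:P))`_m.

Lemma taylor_coefE q x m :
  taylor_coef q x m = \sum_(0 <= k < size q) 'C(k, m)%:R * q`_k * x ^+ (k - m).
Proof.
rewrite /taylor_coef comp_polyE coef_sum big_mkord; apply: eq_bigr => k _.
rewrite coefZ addrC -[in LHS](scale1r 'X) coef_affine_exp expr1n mulr1.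
by rewrite mulrCA mulrA.
Qed.

Let v N m : R := 'C(N, m)%:R * 2^-1 ^+ (N - m) * c ^- N.

(** Multiplication by $n+x$ turns the truncation error into an $N$-th power whose Taylor
    coefficients are bounded by [v N m]. Solving for the [m]-th coefficient of the error brings in
    the previous one and a division by $n+x\ge n$. *)
Fixpoint resolvent_err N m : R :=
  if m is m'.+1 then n^-1 * (resolvent_err N m' + v N m) else n^-1 * v N 0.

Let v_ge0 N m : 0 <= v N m.
Proof.
apply: mulr_ge0; last by rewrite invr_ge0 exprn_ge0// ltW.
by apply: mulr_ge0; rewrite ?ler0n// exprn_ge0// invr_ge0.
Qed.

Lemma resolvent_err_ge0 N m : 0 <= resolvent_err N m.
Proof.
elim: m => [|m IH] /=; rewrite mulr_ge0 ?invr_ge0 ?(ltW n_gt0)//.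
by rewrite addr_ge0.
Qed.

Let taylor_coef_rec N x m : (n + x) * taylor_coef (resolvent_poly N) x m =
    (m == 0%N)%:R - 'C(N, m)%:R * (- c^-1 * (x - 2^-1)) ^+ (N - m) * (- c^-1) ^+ m
    - (if m is m'.+1 then taylor_coef (resolvent_poly N) x m' else 0).
Proof.
have := congr1 (fun q => (q \Po ('X + x%:P))`_m) (resolvent_polyM N).
rewrite /= comp_polyM [(1 - _) \Po _]comp_polyB comp_polyD !comp_polyC comp_polyX.
rewrite [_ ^+ N \Po _]rmorphXn/= [(_ *: (_ - _)) \Po _]comp_polyZ.
rewrite [(_ - _) \Po _]comp_polyB comp_polyX comp_polyC.
have -> : - c^-1 *: ('X + x%:P - (2^-1)%:P) =
    (- c^-1 * (x - 2^-1))%:P + (- c^-1) *: 'X.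
  by rewrite polyCM mul_polyC polyCB -scalerDr -addrA addrC.
rewrite coefB coef1 coef_affine_exp addrCA addrC mulrDl coefD -polyCD.
rewrite coefCM coefXM -!/(taylor_coef _ _ _).
by case: m => [|m] /= <-; rewrite ?addr0 ?subr0// addrK.
Qed.

(** The coefficients $(-1)^m(n+x)^{-m-1}$ of $1/(n+x)$ obey the recursion [taylor_coef_rec] without
    the remainder, so the difference obeys the recursion behind [resolvent_err]. *)
Lemma resolvent_errP N m x : 0 <= x <= 1 ->
  `|taylor_coef (resolvent_poly N) x m - (-1) ^+ m * (n + x) ^- m.+1|
    <= resolvent_err N m.
Proof.
move=> /andP[x0 x1].
have nx : 0 < n + x by rewrite ltr_wpDr.
have z_le : `|- c^-1 * (x - 2^-1)| <= 2^-1 / c.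
  rewrite normrM normrN (@gtr0_norm _ c^-1) ?invr_gt0// mulrC.
  by rewrite ler_wpM2r ?invr_ge0 ?(ltW c_gt0)// ler_norml; lra.
have nz k : `|'C(N, k)%:R * (- c^-1 * (x - 2^-1)) ^+ (N - k) * (- c^-1) ^+ k| <= v N k.
  case: (leqP k N) => kN; last by rewrite bin_small// !mul0r normr0.
  rewrite !normrM !normrX normr_nat [`|- c^-1|]normrN (@gtr0_norm _ c^-1) ?invr_gt0//.
  have cN : c ^- N = c ^- (N - k) * c ^- k by rewrite -{1}(subnK kN) exprD invfM.
  rewrite /v cN -[X in X <= _]mulrA -[X in _ <= X]mulrA ler_wpM2l ?ler0n//.
  rewrite [X in _ <= X]mulrA [c^-1 ^+ k]exprVn.
  rewrite ler_wpM2r ?invr_ge0 ?exprn_ge0 ?(ltW c_gt0)//.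
  rewrite -[c ^- (N - k)]exprVn -exprMn lerXn2r ?nnegrE//.
  by rewrite mulr_ge0// invr_ge0 ltW.
have step (a e : R) : 0 <= e -> `|(n + x) * a| <= e -> `|a| <= n^-1 * e.
  move=> e0; rewrite normrM gtr0_norm// -ler_pdivlMl// => /le_trans; apply.
  by rewrite ler_wpM2r// lef_pV2 ?posrE// lerDl.
elim: m => [|m IH] /=.
  apply: step => //; rewrite mulrBr taylor_coef_rec expr1.
  rewrite [(-1) ^+ 0]expr0 mul1r (divff (lt0r_neq0 nx)) eqxx subr0 addrAC subrr.
  by rewrite sub0r normrN nz.
apply: step; first by rewrite addr_ge0// resolvent_err_ge0.
rewrite mulrBr taylor_coef_rec /= sub0r.
have -> : (n + x) * ((-1) ^+ m.+1 * (n + x) ^- m.+2) = - ((-1) ^+ m * (n + x) ^- m.+1).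
  by rewrite [(n + x) ^+ m.+2]exprS invfM exprS mulrCA mulVKf ?gt_eqF// mulN1r mulNr.
rewrite -addrA -!opprD normrN addrC; apply: (le_trans (ler_normD _ _)).
by apply: lerD.
Qed.

(** For the generating functions $E$ of the errors and $V$ of the [v N m], the recursion reads
    $nE(\rho)=V(\rho)+\rho E(\rho)$, and $V(\rho)=((1/2+\rho)/c)^N$ by the binomial theorem.
    Truncating the sums turns equality into an inequality. *)
Lemma sum_resolvent_err rho N : 0 <= rho < n ->
  \sum_(0 <= m < N) rho ^+ m * resolvent_err N m
    <= ((2^-1 + rho) / c) ^+ N / (n - rho).
Proof.
move=> /andP[rho0 rhon].
rewrite ler_pdivlMr ?subr_gt0// mulrBr lerBlDr.
have vsum : \sum_(0 <= m < N.+1) rho ^+ m * v N m = ((2^-1 + rho) / c) ^+ N.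
  rewrite big_mkord exprMn exprDn mulr_suml; apply: eq_bigr => m _.
  rewrite /v [c^-1 ^+ N]exprVn !mulrA; congr (_ * _).
  by rewrite -[RHS]mulr_natl [rho ^+ m * _]mulrC -!mulrA; congr (_ * _); exact: mulrC.
rewrite -vsum.
suff H K : n * \sum_(0 <= m < K) rho ^+ m * resolvent_err N m <=
  \sum_(0 <= m < K) rho ^+ m * v N m +
  rho * \sum_(0 <= m < K) rho ^+ m * resolvent_err N m.
  rewrite mulrC [_ * rho]mulrC (le_trans (H N))// lerD2r big_nat_recr//= lerDl.
  by rewrite mulr_ge0// exprn_ge0.
rewrite !mulr_sumr.
have nE m : n * (rho ^+ m.+1 * resolvent_err N m.+1) =
   rho * (rho ^+ m * resolvent_err N m) + rho ^+ m.+1 * v N m.+1.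
  by rewrite /= exprS; field; rewrite gt_eqF.
case: K => [|K]; first by rewrite !big_geq// addr0.
rewrite big_nat_recl//= (eq_bigr _ (fun m _ => nE m)) big_split/=.
rewrite [X in _ <= X + _]big_nat_recl//= [X in _ <= _ + X]big_nat_recr//=.
rewrite [n * _](_ : _ = v N 0); last by rewrite expr0 mul1r mulVKf ?gt_eqF.
rewrite expr0 mul1r -!addrA lerD2l [leLHS]addrC lerD2l lerDl.
by rewrite !mulr_ge0// ?exprn_ge0// resolvent_err_ge0.
Qed.

End resolvent.

(** * Integration against countable combinations of measures *)

Section countable_combinations.
Local Open Scope ereal_scope.
Context d (X : measurableType d) (R : realType) (T : countType).
Implicit Types (D : set T) (c : T -> R).

Let esum_pickle D (F : T -> \bar R) : (forall g, 0 <= F g) ->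
  \sum_(n <oo) (if @pickle_inv T n is Some g then if g \in D then F g else 0 else 0)
  = \esum_(g in D) F g.
Proof.
move=> F0; rewrite nneseries_esumT; last first.
  by move=> n; case: (@pickle_inv T _) => // g; case: ifP.
pose F' n := if @pickle_inv T n is Some g then if g \in D then F g else 0 else 0.
transitivity (\esum_(n in pickle @` D) F' n).
  rewrite [RHS]esum_mkcond; apply: eq_esum => n _; rewrite /F'.
  case: ifPn => //; rewrite notin_setE => nD.
  case nE: (@pickle_inv T n) => [g|]//; case: ifPn => // /set_mem gD.
  exfalso; apply: nD; exists g => //.
  by have := @pickle_invK T n; rewrite nE.
rewrite esum_image; last by move=> g h _ _; exact: (pcan_inj pickleK_inv).
by apply: eq_esum => g gD; rewrite /F' pickleK_inv mem_set.
Qed.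

Lemma ge0_integral_esum_measure D c (ms : T -> {measure set X -> \bar R})
    (m : {measure set X -> \bar R}) (E : set X) (f : X -> \bar R) :
  (forall g, (0 <= c g)%R) ->
  (forall A, measurable A -> m A = \esum_(g in D) ((c g)%:E * ms g A)) ->
  measurable E -> measurable_fun E f -> (forall x, E x -> 0 <= f x) ->
  \int[m]_(x in E) f x = \esum_(g in D) ((c g)%:E * \int[ms g]_(x in E) f x).
Proof.
move=> c0 mE mE' mf f0.
pose M n : {measure set X -> \bar R} :=
  if @pickle_inv T n is Some g then
    if g \in D then (mscale (NngNum (c0 g)) (ms g) : {measure set X -> \bar R})
    else (mzero : {measure set X -> \bar R})
  else (mzero : {measure set X -> \bar R}).
rewrite (eq_measure_integral (mseries M 0)); last first.
  move=> A mA _; rewrite mE// -esum_pickle; last first.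
    by move=> g; rewrite mule_ge0 ?lee_fin.
  rewrite /mseries; apply: eq_eseriesr => n _.
  by rewrite /M; case: (@pickle_inv T _) => // g; case: ifP.
rewrite ge0_integral_measure_series// -esum_pickle; last first.
  by move=> g; rewrite mule_ge0 ?lee_fin// integral_ge0.
apply: eq_eseriesr => n _; rewrite /M; case: (@pickle_inv T _) => [g|].
  case: ifP => _; last exact: integral_measure_zero.
  by rewrite ge0_integral_mscale.
exact: integral_measure_zero.
Qed.

End countable_combinations.

Lemma poly_eq0_itv (R : realType) (p : {poly R}) :
  (forall x, 0 <= x <= 1 -> p.[x] = 0) -> p = 0.
Proof.
move=> p0; apply/eqP/negPn/negP => pn0.
pose rs : seq R := [seq k.+1%:R^-1 | k <- iota 0 (size p)].
have : (size rs < size p)%N.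
  apply: max_poly_roots => //.
    apply/allP => _ /mapP[k _ ->]; rewrite /root p0//.
    by rewrite invr_ge0 ler0n/= invf_le1 ?ltr0n// ler1n.
  rewrite map_inj_uniq ?iota_uniq// => i j /invr_inj/eqP.
  by rewrite eqr_nat => /eqP[].
by rewrite size_map size_iota ltnn.
Qed.
                                      

(** * The points $x(g)$ and the maps $\phi_g$ *)

Section word_points.
Variables (R : realType) (b : nat) (hb : (1 < b)%N).
Implicit Types g h : word b.

Lemma word_val_cat g h :
  word_val (g ++ h) = (word_val g * b ^ size h + word_val h)%N.
Proof.
elim/last_ind: h => [|h d IH]; first by rewrite cats0 muln1 addn0.
by rewrite -rcons_cat /word_val !foldl_rcons -!/(word_val _) IH size_rcons expnS; ring.
Qed.

Lemma word_val_lt g : (word_val g < b ^ size g)%N.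
Proof.
elim/last_ind: g => [//|g d IH].
rewrite /word_val foldl_rcons -/(word_val _) size_rcons expnS.
have := ltn_ord d; move: IH; set B := (b ^ _)%N; set v := word_val g => vB db.
have : (v.+1 * b <= B * b)%N by rewrite leq_mul2r vB orbT.
by lia.
Qed.

Let b_gt0 : (0 : R) < b%:R. Proof. by rewrite ltr0n (ltn_trans _ hb). Qed.

Lemma word_weight_ge0 k : 0 <= b%:R ^- k :> R.
Proof. by rewrite invr_ge0 exprn_ge0. Qed.

Lemma word_pt_ge0 g : 0 <= word_pt R g.
Proof. by rewrite divr_ge0// exprn_ge0. Qed.

Lemma word_pt_lt1 g : word_pt R g < 1.
Proof. by rewrite ltr_pdivrMr ?exprn_gt0// mul1r -natrX ltr_nat word_val_lt. Qed.

Lemma word_pt_addV_le1 g : word_pt R g + b%:R ^- size g <= 1.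
Proof.
rewrite -[_ ^- _]mul1r -mulrDl ler_pdivrMr ?exprn_gt0// mul1r.
by rewrite -natrX natr1 ler_nat word_val_lt.
Qed.

Lemma phi_itv g (x : R) : 0 <= x <= 1 -> 0 <= phi g x <= 1.
Proof.
move=> /andP[x0 x1]; rewrite /phi addr_ge0 ?mulr_ge0 ?word_pt_ge0 ?word_weight_ge0//=.
rewrite (le_trans _ (word_pt_addV_le1 g))// lerD2l.
by rewrite ler_piMr// word_weight_ge0.
Qed.

End word_points.

(** * The matrix of $\mathsf K_w$ on monomials *)

Section return_words.
Variables (R : realType) (b p : nat) (hb : (1 < b)%N) (hp : (1 <= p)%N).
Let w := zeros hb p.
Implicit Types g h : word b.

Let b_gt0 : (0 : R) < b%:R. Proof. by rewrite ltr0n (ltn_trans _ hb). Qed.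

Let bV_le1 : (b%:R : R)^-1 <= 1.
Proof. by rewrite invf_le1// ler1n ltnW. Qed.

(** Deleting the final zero embeds $\mathcal G$ into $\mathcal F$. *)
Lemma langG_esum_lty : (\esum_(g in langG w) (b%:R ^- size g : R)%:E < +oo)%E.
Proof.
pose z : 'I_b := Ordinal (ltnW hb).
apply: le_lt_trans (word_pow_esum_lty R hb (zeros_neq0 hb hp)).
apply: (@le_trans _ _ (\esum_(g in rcons^~ z @` langF w) (b%:R ^- size g : R)%:E)%E).
  apply: le_esum_subset => [g /(langG_rcons hp)[h -> hF]|g]; first by exists h.
  by rewrite lee_fin word_weight_ge0.
rewrite esum_image; last by move=> g h _ _ /rcons_inj[].
apply: le_esum => g _; rewrite lee_fin size_rcons exprS invfM.
by rewrite ler_piMl// word_weight_ge0.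
Qed.

                                                                             
                                                      
(** The matrix entries of the operator: $\mathsf K_wx^k=\sum_i\binom ki\,$[gmom i (k - i)]$\,x^i$.
    The diagonal ones, [gmom i 0], are the eigenvalues $\lambda_{i+1}$. *)
Definition gmom i l : R :=
  fine (\esum_(g in langG w) (b%:R ^- (i.+1 * size g) * word_pt R g ^+ l)%:E).

Let gterm_ge0 i l g : 0 <= b%:R ^- (i.+1 * size g) * word_pt R g ^+ l.
Proof. by rewrite mulr_ge0 ?word_weight_ge0// exprn_ge0// word_pt_ge0. Qed.

Let gterm_lty i l :
  (\esum_(g in langG w) (b%:R ^- (i.+1 * size g) * word_pt R g ^+ l)%:E < +oo)%E.
Proof.
apply: le_lt_trans langG_esum_lty; apply: le_esum => g _; rewrite lee_fin.
rewrite (@le_trans _ _ (b%:R ^- (i.+1 * size g)))//.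
  by rewrite ler_piMr ?word_weight_ge0// exprn_ile1 ?word_pt_ge0// ltW// word_pt_lt1.
by rewrite lef_pV2 ?posrE ?exprn_gt0// ler_weXn2l ?ler1n ?(ltnW hb)// leq_pmull.
Qed.

Lemma gmomE i l :
  (\esum_(g in langG w) (b%:R ^- (i.+1 * size g) * word_pt R g ^+ l)%:E
    = (gmom i l)%:E)%E.
Proof.
rewrite fineK// ge0_fin_numE//; apply: esum_ge0 => g _.
by rewrite lee_fin gterm_ge0.
Qed.

Lemma lambda_gmom i : lambda R w i.+1 = (gmom i 0)%:E.
Proof. by rewrite -gmomE; apply: eq_esum => g _; rewrite expr0 mulr1. Qed.

Lemma gmom_ge0 i l : 0 <= gmom i l.
Proof. by rewrite fine_ge0// esum_ge0// => g _; rewrite lee_fin. Qed.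

Lemma phi_expandE j k g x :
  b%:R ^- (j.+1 * size g) * phi g x ^+ k =
  \sum_(0 <= i < k.+1) ('C(k, i)%:R * x ^+ i) *
     (b%:R ^- ((i + j).+1 * size g) * word_pt R g ^+ (k - i)).
Proof.
rewrite /phi exprDn mulr_sumr big_mkord; apply: eq_bigr => i _.
have -> : b%:R ^- ((i + j).+1 * size g) =
    b%:R ^- (j.+1 * size g) * (b%:R ^- size g) ^+ i :> R.
  by rewrite -!exprVn -exprM -exprD; congr (_ ^+ _); ring.
rewrite -[_ *+ 'C(k, i)]mulr_natl.
have ac (S C P Q y : R) : S * (C * (P * (Q * y))) = C * y * (S * Q * P) by ring.
by rewrite [(_ * x) ^+ i]exprMn ac.
Qed.

(** With [y i] the power $x^i$ and [j = 0] this is the action of $\mathsf K_w$ on $x^k$; with [y i]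
    the moments of $\nu_{j+1}$ it is the self-similarity relation of that measure. *)
Lemma esum_phi_expand j k (y : nat -> R) : (forall i, 0 <= y i) ->
  (\esum_(g in langG w) (\sum_(0 <= i < k.+1) ('C(k, i)%:R * y i) *
     (b%:R ^- ((i + j).+1 * size g) * word_pt R g ^+ (k - i)))%:E =
   (\sum_(0 <= i < k.+1) 'C(k, i)%:R * gmom (i + j) (k - i) * y i)%:E)%E.
Proof.
move=> y0; under eq_esum do rewrite -sumEFin.
rewrite esum_sum; last by move=> g i _ _; rewrite lee_fin mulr_ge0 ?gterm_ge0// mulr_ge0.
rewrite -sumEFin; apply: eq_bigr => i _.
rewrite esumZl_fin; last 2 first.
- by rewrite mulr_ge0.
- by move=> g; exact: gterm_ge0.
by rewrite gmomE -EFinM; congr _%:E; ring.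
Qed.

Lemma is_B_eigen m (B : {poly R}) : is_B w m B -> forall i, (i <= m)%N ->
  \sum_(i <= k < m.+1) 'C(k, i)%:R * gmom i (k - i) * B`_k = gmom m 0 * B`_i.
Proof.
move=> [_ sizeB BE] i im.
(* [Q] is $\mathsf K_wB$ as a polynomial. It agrees with $\lambda_{m+1}B$ on $[0,1]$, hence
   everywhere, and the coefficients can be compared. *)
pose Q : {poly R} := \sum_(0 <= k < m.+1) B`_k *:
  \sum_(0 <= i < k.+1) ('C(k, i)%:R * gmom i (k - i)) *: 'X^i.
have QE : Q = gmom m 0 *: B.
  apply/eqP; rewrite -subr_eq0; apply/eqP/poly_eq0_itv => x x01.
  apply/eqP; rewrite hornerD hornerN subr_eq0 hornerZ; apply/eqP.
  apply: EFin_inj; rewrite EFinM -lambda_gmom -BE; last by rewrite in_itv.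
  have f0 k g : 0 <= b%:R ^- size g * phi g x ^+ k.
    by have /andP[? _] := phi_itv hb g x01; rewrite mulr_ge0 ?word_weight_ge0// exprn_ge0.
  have fE k : (\esum_(g in langG w) (b%:R ^- size g * phi g x ^+ k)%:E =
     (\sum_(0 <= i < k.+1) 'C(k, i)%:R * gmom i (k - i) * x ^+ i)%:E)%E.
    have /andP[x0 _] := x01.
    under [in RHS]eq_bigr => l _ do rewrite -[l in gmom l]addn0.
    rewrite -esum_phi_expand; last by move=> l; rewrite exprn_ge0.
    by apply: eq_esum => g _; rewrite -phi_expandE mul1n.
  have sE : (fun g => (b%:R ^- size g * B.[phi g x])%:E) =
      (fun g => (\sum_(0 <= k < m.+1) B`_k * (b%:R ^- size g * phi g x ^+ k))%:E).
    apply/funext => g; rewrite horner_coef sizeB mulr_sumr big_mkord.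
    by congr _%:E; apply: eq_bigr => k _; rewrite mulrCA.
  rewrite /opK /= sE esum_pos_neg_linear => //; last first.
    by move=> k; rewrite fE ltry.
  congr _%:E; rewrite /Q horner_sum; apply: eq_bigr => k _; rewrite hornerZ fE /=.
  rewrite horner_sum; congr (_ * _); apply: eq_bigr => l _.
  by rewrite hornerZ hornerXn.
have := congr1 (fun q : {poly R} => q`_i) QE.
rewrite /= coefZ => <-; rewrite /Q coef_sum.
rewrite (@big_cat_nat _ _ _ i 0)//=; last by rewrite ltnW.
rewrite [X in _ = X + _]big1_seq ?add0r; last first.
  move=> k; rewrite mem_index_iota => /andP[_ ki].
  rewrite coefZ coef_sum big1_seq ?mulr0// => l.
  rewrite mem_index_iota coefZ coefXn => /andP[_ lk].
  by rewrite (_ : (i == l) = false) ?mulr0//; lia.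
apply: eq_big_nat => k /andP[ik km]; rewrite coefZ coef_sum.
rewrite (bigD1_seq i) ?mem_index_iota ?iota_uniq//=.
rewrite coefZ coefXn eqxx mulr1 big1 ?addr0; first by rewrite mulrC.
by move=> l /negbTE li; rewrite coefZ coefXn eq_sym li mulr0.
Qed.

(** In $\lambda_{i+1}-\lambda_{m+1}$ all words of $\mathcal G$ contribute non-negatively, and the
    word $0$ alone contributes $b^{-(i+1)}-b^{-(m+1)}$. *)
Lemma gmom_gap i m : (i < m)%N ->
  b%:R ^- i.+1 * (1 - b%:R^-1) <= gmom i 0 - gmom m 0.
Proof.
move=> im; rewrite lerBrDr -lee_fin EFinD -!gmomE.
set gap := _ * _.
have powE k g : b%:R ^- (k.+1 * size g) * word_pt R g ^+ 0 = (b%:R ^- size g) ^+ k.+1.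
  by rewrite expr0 mulr1 mulnC -!exprVn -exprM.
have V_le1 g : b%:R ^- size g <= 1 :> R by rewrite -exprVn exprn_ile1// invr_ge0.
have gap0 : 0 <= gap by rewrite mulr_ge0 ?word_weight_ge0// subr_ge0.
pose z : 'I_b := Ordinal (ltnW hb).
(* The bound is written as a sum carried by the single word $0$, so that the comparison becomes
   termwise. *)
have -> : (gap%:E = \esum_(g in langG w) (if g \in [set [:: z]] then gap%:E else 0))%E.
  rewrite -esum_mkcondr (_ : _ `&` _ = [set [:: z]]) ?esum_set1 ?lee_fin//.
  by apply/seteqP; split=> [g []//|_ ->]; split => //; exact: langG_zero.
rewrite -esumD; last 2 first.
- by move=> g _; case: ifP => _; rewrite ?lee_fin.
- by move=> g _; rewrite lee_fin.
apply: le_esum => g _; rewrite !powE.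
case: ifPn => [/set_mem/= ->|_]; last first.
  by rewrite add0e lee_fin ler_wiXn2l ?word_weight_ge0// ltnS ltnW.
rewrite -EFinD lee_fin /= expr1 /gap mulrBr mulr1 -exprVn -exprSr.
by rewrite -lerBrDl opprB addrC subrK ler_wiXn2l ?invr_ge0// ltnS.
Qed.

                                                                          
                                                                                
                                                               
(** Write $g=h0$, so that $x(g)=x(h)$ and a factor $b^{-(i+1)}$ splits off. With $\beta=b^{-|h|}$,
    what remains contains $\binom ki x(h)^{k-i}(\tfrac32\beta)^i$, one term of
    $(x(h)+\tfrac32\beta)^k$. For non-empty $h$, $x(h)+\beta\le1$ and $\beta\le1/2$ bound the base
    by $5/4$. *)
Lemma gmom_growth i k : (i < k)%N ->
  'C(k, i)%:R * gmom i (k - i) * (3 / 2) ^+ i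
    <= b%:R ^- i.+1 * (b%:R * gmom 0 0) * (5 / 4) ^+ k.
Proof.
move=> ik.
have lhsE : (('C(k, i)%:R * (3 / 2) ^+ i * gmom i (k - i))%:E =
    \esum_(g in langG w) ('C(k, i)%:R * (3 / 2) ^+ i *
      (b%:R ^- (i.+1 * size g) * word_pt R g ^+ (k - i)))%:E)%E.
  by rewrite esumZl_fin ?mulr_ge0 ?exprn_ge0// gmomE.
have rhsE : ((b%:R ^- i.+1 * b%:R * (5 / 4) ^+ k * gmom 0 0)%:E =
    \esum_(g in langG w) (b%:R ^- i.+1 * b%:R * (5 / 4) ^+ k *
      (b%:R ^- (1 * size g) * word_pt R g ^+ 0))%:E)%E.
  by rewrite esumZl_fin ?mulr_ge0 ?exprn_ge0 ?word_weight_ge0// gmomE.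
rewrite mulrAC !mulrA [leRHS]mulrAC -lee_fin lhsE rhsE.
apply: le_esum => g /(langG_rcons hp)[h -> _]; rewrite lee_fin.
have xh : word_pt R (rcons h (Ordinal (ltnW hb))) = word_pt R h.
  rewrite /word_pt /word_val foldl_rcons addn0 size_rcons exprSr natrM invfM.
  by rewrite mulrACA divff ?gt_eqF// mulr1.
rewrite xh size_rcons expr0 mulr1 mul1n.
set x := word_pt R h; pose B : R := b%:R ^- size h.
have x0 : 0 <= x by exact: word_pt_ge0.
have B0 : 0 <= B by exact: word_weight_ge0.
have -> : b%:R ^- (i.+1 * (size h).+1) = b%:R ^- i.+1 * (B ^+ i * B) :> R.
  rewrite /B -!exprVn -exprSr -exprM -exprD; congr (_ ^+ _); ring.
have -> : b%:R ^- (size h).+1 = b%:R^-1 * B :> R.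
  by rewrite /B exprS invfM.
have lhs_eq (C r V Q S X : R) :
  C * r * (V * (Q * S) * X) = (V * S) * (C * (r * Q) * X) by ring.
have rhs_eq (V c s c' S : R) :
  V * c * s * (c' * S) = (c' * c) * ((V * S) * s) by ring.
rewrite lhs_eq rhs_eq mulVf ?gt_eqF// mul1r ler_wpM2l ?mulr_ge0 ?word_weight_ge0//.
rewrite -exprMn.
(* The base would be $3/2$ for empty $h$, but there $x(h)=0$ and the exponent $k-i$ is positive. *)
have [h0|h_neq0] := eqVneq h [::].
  have -> : x = 0 by rewrite /x h0 /word_pt mul0r.
  by rewrite expr0n subn_eq0 leqNgt ik mulr0 exprn_ge0.
have B_le : B <= 1 / 2.
  rewrite div1r lef_pV2 ?posrE ?exprn_gt0//.
  rewrite (@le_trans _ _ b%:R) ?ler_nat// -[leLHS]expr1 ler_weXn2l ?ler1n ?(ltnW hb)//.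
  by case: (h) h_neq0.
have xB : x + 3 / 2 * B <= 5 / 4.
  by have := word_pt_addV_le1 R hb h; rewrite -/x -/B; lra.
rewrite (@le_trans _ _ ((x + 3 / 2 * B) ^+ k))//; last first.
  by rewrite lerXn2r ?nnegrE// addr_ge0// mulr_ge0.
have ik' : (i < k.+1)%N by rewrite ltnS ltnW.
rewrite exprDn (bigD1 (Ordinal ik'))//= -[X in _ <= X + _]mulr_natl.
rewrite [x ^+ _ * _]mulrC mulrA lerDl.
apply: sumr_ge0 => l _; rewrite mulrn_wge0// mulr_ge0// exprn_ge0//.
by rewrite mulr_ge0.
Qed.

End return_words.

(** * Moments of the measures $\nu_j$ *)

Lemma bounded_integrable (R : realType)
    (m : {measure set (measurableTypeR R) -> \bar R})
    (E : set (measurableTypeR R)) (f : R -> R) (C : R) :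
  measurable E -> (m E < +oo)%E ->
  measurable_fun E (f : measurableTypeR R -> R) ->
  (forall x, E x -> `|f x| <= C) -> m.-integrable E (EFin \o f).
Proof.
move=> mE Eoo mf fC; apply: measurable_bounded_integrable => //.
exists C; split; first exact: num_real.
by move=> M CM x Ex; exact: le_trans (fC _ Ex) (ltW CM).
Qed.

Section moments.
Variables (R : realType) (b p : nat) (hb : (1 < b)%N) (hp : (1 <= p)%N).
Let w := zeros hb p.
Variables (j : nat) (nu : probability (measurableTypeR R) R).
Hypothesis nuP : is_nu w j.+1 nu.
Implicit Types g : word b.

Definition moment k : R := \int[nu]_(x in `[0, 1]) x ^+ k.

Let m01 : measurable (`[0, 1]%classic : set (measurableTypeR R)).
Proof. exact: measurable_itv. Qed.

Let nu_lty A : (measurable A -> nu A < +oo)%E.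
Proof. by move=> mA; rewrite (le_lt_trans (probability_le1 _ _))// ltry. Qed.

Lemma moment_integrable k :
  nu.-integrable `[0, 1] (EFin \o (fun x : measurableTypeR R => x ^+ k : R)).
Proof.
apply: (@bounded_integrable _ _ _ _ 1) => //; first exact: nu_lty.
move=> x /=; rewrite in_itv/= => /andP[x0 x1].
by rewrite ger0_norm ?exprn_ge0// exprn_ile1.
Qed.

Lemma momentE k : (\int[nu]_(x in `[0%R, 1%R]) (x ^+ k)%:E = (moment k)%:E)%E.
Proof.
by rewrite fineK//; apply: integrable_fin_num => //; exact: moment_integrable.
Qed.

Lemma moment_ge0 k : 0 <= moment k.
Proof.
by apply: Rintegral_ge0 => x /=; rewrite in_itv/= => /andP[x0 _]; rewrite exprn_ge0.
Qed.

Lemma moment0 : moment 0 = 1.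
Proof.
apply: EFin_inj; rewrite -momentE; under eq_integral do rewrite expr0.
by rewrite integral_cst// mul1e; case: nuP.
Qed.

Let phiT g : measurableTypeR R -> measurableTypeR R := phi g.

Let mphi g : measurable_fun setT (phiT g).
Proof.
apply: measurable_funD => //; exact: measurable_funM.
Qed.

Let push g : {measure set (measurableTypeR R) -> \bar R} :=
  measure_function_pushforward__canonical__measure_function_Measure nu (mphi g).

Let integral_push g k :
  (\int[push g]_(x in `[0%R, 1%R]) (x ^+ k)%:E =
   \int[nu]_(x in `[0%R, 1%R]) (phi g x ^+ k)%:E)%E.
Proof.
have mf : measurable_fun (`[0, 1]%classic : set (measurableTypeR R))
    (fun x : measurableTypeR R => (x ^+ k : R)%:E).
  by apply/measurable_EFinP; exact: measurable_funX.
rewrite (ge0_integral_pushforward (mphi g))//; last first.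
  by move=> x /set_mem /=; rewrite in_itv/= => /andP[x0 _]; rewrite lee_fin exprn_ge0.
set E := _ @^-1` _.
have mE : measurable E by rewrite -[E]setTI; exact: mphi.
(* Since $\phi_g$ maps $[0,1]$ into itself and $\nu$ is carried by $[0,1]$, the preimage of $[0,1]$
   may be replaced by $[0,1]$. *)
have E01 : `[0, 1]%classic `<=` E.
  by move=> x /=; rewrite !in_itv/=; exact: phi_itv.
rewrite (@negligible_integral _ _ _ _ E
  (~` (`[0, 1]%classic : set (measurableTypeR R))))//.
- by rewrite setDE setCK setIC (setIidl E01).
- exact: measurableC.
- apply: (@bounded_integrable _ _ _ _ 1) => //; first exact: nu_lty.
    apply: measurable_funX; apply: measurable_funTS; exact: mphi.
  move=> x; rewrite /E /= in_itv/= => /andP[x0 x1].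
  by rewrite ger0_norm ?exprn_ge0// exprn_ile1.
- by apply: (etrans (probability_setC nu m01)); case: nuP => -> _; rewrite subee.
Qed.

(** Integrate $x^k$ against the self-similarity equation of $\nu_{j+1}$ and expand $\phi_g(x)^k$. *)
Lemma moment_eigen k :
  \sum_(0 <= i < k.+1) 'C(k, i)%:R * gmom R p hb (i + j) (k - i) * moment i =
  gmom R p hb j 0 * moment k.
Proof.
apply: EFin_inj; rewrite -(esum_phi_expand hb hp); last exact: moment_ge0.
have gm0 : 0 <= gmom R p hb j 0 by exact: gmom_ge0.
pose m : {measure set (measurableTypeR R) -> \bar R} := mscale (NngNum gm0) nu.
have mP A : measurable A -> m A = (\esum_(g in langG w)
    ((b%:R ^- (j.+1 * size g))%:E * push g A))%E.
  move=> mA; have -> : m A = ((gmom R p hb j 0)%:E * nu A)%E by [].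
  by rewrite -lambda_gmom//; case: nuP => _ /(_ A mA)/esym.
have mf : measurable_fun (`[0, 1]%classic : set (measurableTypeR R))
    (fun x : measurableTypeR R => (x ^+ k : R)%:E).
  by apply/measurable_EFinP; exact: measurable_funX.
have f0 (x : measurableTypeR R) : `[0, 1]%classic x -> (0 <= (x ^+ k : R)%:E)%E.
  by rewrite /= in_itv/= => /andP[x0 _]; rewrite lee_fin exprn_ge0.
have := ge0_integral_esum_measure (fun g => @word_weight_ge0 R b (j.+1 * size g))
  mP m01 mf f0.
rewrite ge0_integral_mscale// momentE -EFinM => ->.
apply: eq_esum => g _; rewrite integral_push.
have phi0 x : x \in `[0, 1] -> 0 <= phi g x.
  by rewrite in_itv/= => /(phi_itv hb g)/andP[].
rewrite -ge0_integralZl_EFin ?word_weight_ge0//; last 2 first.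
- by move=> x /phi0 x0; rewrite lee_fin exprn_ge0.
- apply/measurable_EFinP; apply: measurable_funX; apply: measurable_funTS; exact: mphi.
under [RHS]eq_integral => x _.
  rewrite -EFinM phi_expandE -sumEFin; over.
rewrite ge0_integral_sum//; last 2 first.
- move=> i; apply/measurable_EFinP; apply: measurable_funM => //.
  by apply: measurable_funM => //; exact: measurable_funX.
- move=> i x; rewrite /= in_itv/= => /andP[x0 _].
  rewrite lee_fin !mulr_ge0 ?exprn_ge0 ?word_weight_ge0//.
  exact: word_pt_ge0.
rewrite -sumEFin; apply: eq_bigr => i _.
under eq_integral => x _ do rewrite mulrAC EFinM.
rewrite integralZl ?momentE ?moment_integrable//.
by rewrite -EFinM mulrAC.
Qed.

End moments.

(** * Bounds and integrability of $(n+x)^{-j}$ *)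

Section integral_bounds.
Variables (R : realType) (m : {measure set (measurableTypeR R) -> \bar R}).
Variable E : set (measurableTypeR R).
Hypothesis mE : measurable E.
Hypothesis Eoo : (m E < +oo)%E.

Lemma normr_Rintegral_le (f : measurableTypeR R -> R) (C : R) :
  m.-integrable E (EFin \o f) -> (forall x, E x -> `|f x| <= C) ->
  `|\int[m]_(x in E) f x| <= C * fine (m E).
Proof.
move=> mf fC; rewrite (le_trans (le_normr_Rintegral mE mf))// -Rintegral_cst//.
apply: le_Rintegral => //; first exact: integrable_norm.
apply: (@bounded_integrable _ _ _ _ `|C|) => //.
Qed.

Lemma measurable_resolvent (n : R) j : 0 < n -> E `<=` `[0, 1]%classic ->
  measurable_fun E (fun x : measurableTypeR R => (n + x) ^- j : R).
Proof.
move=> n0 E01; under eq_fun do rewrite -exprVn.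
apply: measurable_funX; apply: subspace_continuous_measurable_fun => //.
apply: continuous_in_subspaceT => x /set_mem/E01 /=; rewrite in_itv/= => /andP[x0 _].
apply: cvgV; first by rewrite gt_eqF// ltr_wpDr.
by apply: cvgD; [exact: cvg_cst|exact: cvg_id].
Qed.

Lemma resolvent_integrable (n : R) j : 0 < n -> E `<=` `[0, 1]%classic ->
  m.-integrable E (EFin \o (fun x : measurableTypeR R => (n + x) ^- j : R)).
Proof.
move=> n0 E01; apply: (@bounded_integrable _ _ _ _ (n ^- j)) => //.
  exact: measurable_resolvent.
move=> x /E01 /=; rewrite in_itv/= => /andP[x0 x1].
have nx : 0 < n + x by rewrite ltr_wpDr.
rewrite ger0_norm ?invr_ge0 ?exprn_ge0 ?(ltW nx)//.
by rewrite lef_pV2 ?posrE ?exprn_gt0// lerXn2r ?nnegrE ?(ltW n0) ?(ltW nx)// lerDl.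
Qed.

End integral_bounds.

                                      

(** * Uniform expansion of $1/(n+x)$ in the eigenpolynomials *)

Section expansion.
Variables (R : realType) (b p : nat) (hb : (1 < b)%N) (hp : (1 <= p)%N).
Let w := zeros hb p.
Variables (nu : nat -> probability (measurableTypeR R) R) (B : nat -> {poly R}).
Hypothesis nuP : forall j, (1 <= j)%N -> is_nu w j (nu j).
Hypothesis BP : forall m, is_B w m (B m).

Let M := @gmom R b p hb.
Let mom i k := moment (nu i.+1) k.
Let lam i := M i 0.
Let dual := dualB mom.
Let rho : R := 3 / 2.

Let b_gt0 : (0 : R) < b%:R. Proof. by rewrite ltr0n (ltn_trans _ hb). Qed.

Let bV_lt1 : (b%:R : R)^-1 < 1.
Proof. by rewrite invf_lt1// ltr1n. Qed.

Let gap_gt0 i : 0 < b%:R ^- i.+1 * (1 - b%:R^-1) :> R.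
Proof. by rewrite mulr_gt0 ?invr_gt0 ?exprn_gt0// subr_gt0. Qed.

Lemma eigenpoly_bounded : exists2 C : R, 0 <= C &
  forall m x, 0 <= x <= 1 -> `|(B m).[x]| <= C * rho ^+ m.
Proof.
(* Chosen so that the gap times [H] is the factor $b^{-(i+1)}\,b\,\lambda_1$ of [gmom_growth]; [rho]
   and $5/4$ come from there too. *)
pose H : R := b%:R * M 0 0 / (1 - b%:R^-1).
have b1 : 0 < 1 - (b%:R : R)^-1 by rewrite subr_gt0.
have H0 : 0 <= H by rewrite mulr_ge0 ?invr_ge0 ?(ltW b1)// mulr_ge0// gmom_ge0.
exists (expR (H / (1 - 5 / 4 / rho))) => [|m x x01]; first exact: expR_ge0.
have [Bmonic sizeB _] := BP m.
have rho1 : 1 <= rho by rewrite /rho; lra.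
rewrite (le_trans (norm_horner_le sizeB x01 rho1))//.
apply: (@eigenpoly_growth R M lam (fun i => b%:R ^- i.+1 * (1 - b%:R^-1))) => //.
- by rewrite /rho; lra.
- by move=> i im; rewrite gap_gt0 gmom_gap.
- exact: gmom_ge0.
- by move=> i im; apply: is_B_eigen => //; exact: ltnW.
move=> i k ik; rewrite (le_trans (gmom_growth R hb hp ik))//.
rewrite le_eqVlt; apply/orP; left; apply/eqP; congr (_ * _).
by rewrite -[RHS]mulrA; congr (_ * _); rewrite /H [RHS]mulrC divfK// gt_eqF.
Qed.

Lemma dual_expansion N (q : {poly R}) : (size q <= N)%N ->
  q = \sum_(0 <= m < N) dual m q *: B m.
Proof.
move=> qN; apply: (@dualB_expansion R M mom lam B) => //.
- by move=> m; case: (BP m).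
- by move=> m; case: (BP m).
- by move=> m i im; apply: is_B_eigen.
- by move=> j k; apply: moment_eigen => //; apply: nuP.
- by move=> j; apply: (moment0 (nuP (ltn0Sn j))).
move=> i m im; rewrite -subr_eq0 gt_eqF//.
by apply: lt_le_trans (gmom_gap R hb hp im); exact: gap_gt0.
Qed.

Let m01 : measurable (`[0, 1]%classic : set (measurableTypeR R)).
Proof. exact: measurable_itv. Qed.

Lemma taylor_coef_integrable i (q : {poly R}) (j : nat) :
  (nu j).-integrable `[0, 1]
    (EFin \o (fun x : measurableTypeR R => taylor_coef q x i)).
Proof.
have -> : EFin \o (fun x : measurableTypeR R => taylor_coef q x i) =
    fun x => (\sum_(0 <= k < size q) ('C(k, i)%:R * q`_k)%:E * (x ^+ (k - i))%:E)%E.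
  apply/funext => x; rewrite /= taylor_coefE -sumEFin.
  by apply: eq_bigr => k _; rewrite EFinM.
apply: integrable_sum => // k _.
apply: integrableZl => //; exact: moment_integrable.
Qed.

Lemma dual_taylor i (q : {poly R}) :
  dual i q = \int[nu i.+1]_(x in `[0, 1]) taylor_coef q x i.
Proof.
rewrite /Rintegral.
have -> : (\int[nu i.+1]_(x in `[0%R, 1%R]) (taylor_coef q x i)%:E =
    \int[nu i.+1]_(x in `[0%R, 1%R])
      \sum_(0 <= k < size q) (('C(k, i)%:R * q`_k)%:E * (x ^+ (k - i))%:E))%E.
  apply: eq_integral => x _; rewrite taylor_coefE -sumEFin.
  by apply: eq_bigr => k _; rewrite EFinM.
rewrite integral_sum//; last first.
  move=> k; apply: integrableZl => //; exact: moment_integrable.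
under eq_bigr => k _.
  rewrite integralZl//; last exact: moment_integrable.
  rewrite momentE -EFinM; over.
by rewrite sumEFin.
Qed.

(** The pointwise Taylor error is integrated against the probability measure $\nu_{m+1}$. *)
Lemma dual_resolvent (n : nat) N m : (0 < n)%N ->
  `|dual m (resolvent_poly n%:R N) - (-1) ^+ m * coefA nu m.+1 n|
    <= resolvent_err n%:R N m.
Proof.
move=> n0; have nR0 : (0 : R) < n%:R by rewrite ltr0n.
have nu1 : nu m.+1 (`[0, 1]%classic : set (measurableTypeR R)) = 1%E.
  by case: (nuP (ltn0Sn m)).
have nu_lty : (nu m.+1 (`[0%R, 1%R]%classic : set (measurableTypeR R)) < +oo)%E.
  by rewrite nu1 ltry.
have hA := resolvent_integrable m01 nu_lty m.+1 nR0 (@subset_refl _ _).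
have hT := taylor_coef_integrable m (resolvent_poly n%:R N) m.+1.
have hA' := integrableZl m01 ((-1) ^+ m) hA.
rewrite dual_taylor /coefA -RintegralZl// -RintegralB//.
rewrite -[leRHS]mulr1 -[X in _ * X]/(fine 1%E) -nu1.
apply: normr_Rintegral_le => //; first exact: (integrableB m01 hT hA').
by move=> x /=; rewrite in_itv/=; exact: resolvent_errP.
Qed.

(** The polynomial approximation expands exactly in the $B_m$. Replacing its coefficients by
    $(-1)^mA_{m+1}(n)$ costs at most $C\rho^m$ times [resolvent_err] in degree $m$, so the same
    weighted sum [S] controls both this error and that of the approximation. *)
Lemma resolvent_expansion : exists2 C : R, 0 <= C &
  forall (n N : nat) x, (2 <= n)%N -> (0 < N)%N -> 0 <= x <= 1 ->
  `|(n%:R + x)^-1 - \sum_(0 <= m < N) (-1) ^+ m * coefA nu m.+1 n * (B m).[x]|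
    <= C * (4 / 5) ^+ N.
Proof.
have [C C0 BC] := eigenpoly_bounded.
exists (2 * (1 + C)) => [|n N x n2 N0 x01]; first by rewrite mulr_ge0// addr_ge0.
have n2R : (2 : R) <= n%:R by rewrite ler_nat.
have nR0 : (0 : R) < n%:R by rewrite (lt_le_trans _ n2R).
pose q := resolvent_poly (n%:R : R) N.
have err_ge0 m := resolvent_err_ge0 nR0 N m.
pose S := \sum_(0 <= m < N) rho ^+ m * resolvent_err n%:R N m.
(* For $n\ge2$ and $\rho=3/2$: $(1/2+\rho)/(n+1/2)\le4/5$ and $1/(n-\rho)\le2$. *)
have S_le : S <= 2 * (4 / 5) ^+ N.
  have rho_n : 0 <= rho < n%:R by rewrite /rho; lra.
  rewrite (le_trans (sum_resolvent_err nR0 N rho_n))// mulrC.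
  have d0 : 0 < (n%:R : R) - rho by rewrite subr_gt0; case/andP: rho_n.
  have r0 : 0 <= (2^-1 + rho) / (n%:R + 2^-1).
    by rewrite divr_ge0 ?addr_ge0 ?invr_ge0// ?(ltW nR0)//; case/andP: rho_n.
  apply: ler_pM; rewrite ?invr_ge0 ?exprn_ge0 ?(ltW d0)//.
    by rewrite -[leRHS]invrK lef_pV2 ?posrE ?invr_gt0// /rho; lra.
  rewrite lerXn2r ?nnegrE// ler_pdivrMr ?addr_gt0 ?invr_gt0// /rho; lra.
have eq0 : `|(n%:R + x)^-1 - q.[x]| <= S.
  rewrite distrC; have := resolvent_errP nR0 N 0 x01.
  have -> : taylor_coef (resolvent_poly n%:R N) x 0 = q.[x].
    rewrite taylor_coefE horner_coef big_mkord; apply: eq_bigr => k _.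
    by rewrite bin0 mul1r subn0.
  rewrite expr0 mul1r expr1 => /le_trans; apply.
  (* The error at [x] is the term $m=0$ of [S], present because $N>0$. *)
  rewrite /S big_ltn// expr0 mul1r lerDl sumr_ge0// => m _.
  by rewrite mulr_ge0// exprn_ge0// /rho; lra.
have eq1 : `|q.[x] -
    \sum_(0 <= m < N) (-1) ^+ m * coefA nu m.+1 n * (B m).[x]| <= C * S.
  rewrite {1}(dual_expansion (size_resolvent_poly _ N : (size q <= N)%N)) horner_sum -sumrB.
  rewrite (le_trans (ler_norm_sum _ _ _))// /S mulr_sumr; apply: ler_sum => m _.
  rewrite hornerZ -mulrBl normrM mulrC.
  rewrite mulrA ler_pM//; first exact: BC.
  by apply: dual_resolvent; rewrite (leq_trans _ n2).
rewrite -(subrKA q.[x]) (le_trans (ler_normD _ _))// (le_trans (lerD eq0 eq1))//.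
rewrite -[X in X + _]mul1r -mulrDl [2 * _]mulrC -mulrA.
by rewrite ler_wpM2l ?addr_ge0.
Qed.

End expansion.

(** * Integration of the expansion against $\mu_0$ and $\eta_0$ *)

Lemma cvg_geometric_bound (R : realType) (v : R^nat) (l K z : R) :
  0 <= z < 1 -> (forall N, (0 < N)%N -> `|l - v N| <= K * z ^+ N) ->
  v @ \oo --> l.
Proof.
move=> /andP[z0 z1] vK; apply/cvgrPdist_le => e e0.
have : geometric K z @ \oo --> (0 : R) by apply: cvg_geometric; rewrite ger0_norm.
move=> /cvgrPdist_le/(_ _ e0) geo.
near=> N; apply: (le_trans (vK N _)); first by near: N; exists 1%N.
have : `|0 - geometric K z N| <= e by near: N.
by rewrite sub0r normrN; apply: le_trans; exact: ler_norm.
Unshelve. all: by end_near. Qed.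

Lemma norm_sum_seq_le (R : numDomainType) (I : eqType) (s : seq I) (f : I -> R) (K : R) :
  (forall a, a \in s -> `|f a| <= K) -> `|\sum_(a <- s) f a| <= (size s)%:R * K.
Proof.
move=> fK; rewrite (le_trans (ler_norm_sum _ _ _))// big_seq.
rewrite (le_trans (ler_sum _ fK))// -big_seq big_const_seq count_predT.
by rewrite iter_addr_0 mulr_natl.
Qed.

Section word_measures.
Variables (R : realType) (b p : nat) (hb : (1 < b)%N) (hp : (1 <= p)%N).
Let w := zeros hb p.
Variable D : set (word b).
Hypothesis DF : D `<=` langF w.

Let mu : {measure set (measurableTypeR R) -> \bar R} := word_measure D.
Let I01 : set (measurableTypeR R) := `[0, 1[%classic.

Let mI01 : measurable I01. Proof. exact: measurable_itv. Qed.

Lemma word_measure_lty : (mu I01 < +oo)%E.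
Proof.
apply: le_lt_trans (word_pow_esum_lty R hb (zeros_neq0 hb hp)).
apply: (@le_trans _ _ (\esum_(g in D) (b%:R ^- size g : R)%:E)%E).
  apply: le_esum => g _; rewrite diracE -EFinM lee_fin ler_piMr ?word_weight_ge0//.
  by case: (_ \in _).
by apply: le_esum_subset => // g; rewrite lee_fin word_weight_ge0.
Qed.

Lemma word_measure_integral (f : measurableTypeR R -> R) :
  measurable_fun I01 f -> (forall x, I01 x -> 0 <= f x) ->
  (\int[mu]_(x in I01) (f x)%:E =
   \esum_(g in D) (b%:R ^- size g * f (word_pt R g))%:E)%E.
Proof.
move=> mf f0.
rewrite (@ge0_integral_esum_measure _ _ R _ D (fun g => b%:R ^- size g)
  (fun g => \d_(word_pt R g : measurableTypeR R)) mu I01)//; last exact/measurable_EFinP.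
apply: eq_esum => g _; rewrite integral_dirac//; last exact/measurable_EFinP.
rewrite diracE mem_set ?mul1e ?EFinM//.
by rewrite /I01 /= in_itv/= word_pt_ge0 word_pt_lt1.
Qed.

End word_measures.

Section series_expansion.
Variables (R : realType) (b p : nat) (hb : (1 < b)%N) (hp : (1 <= p)%N).
Let w := zeros hb p.
Variables (nu : nat -> probability (measurableTypeR R) R) (B : nat -> {poly R}).
Hypothesis nuP : forall j, (1 <= j)%N -> is_nu w j (nu j).
Hypothesis BP : forall m, is_B w m (B m).

Let I01 : set (measurableTypeR R) := `[0, 1[%classic.
Let mI01 : measurable I01. Proof. exact: measurable_itv. Qed.
Let I01_sub : I01 `<=` `[0, 1]%classic.
Proof. by move=> x; rewrite /I01 /= !in_itv/= => /andP[-> /ltW]. Qed.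

Lemma coefA_bound (n m : nat) : (2 <= n)%N -> `|coefA nu m.+1 n| <= 2^-1 ^+ m.
Proof.
move=> n2; have n2R : (2 : R) <= n%:R by rewrite ler_nat.
have nR0 : (0 : R) < n%:R by rewrite (lt_le_trans _ n2R).
have m01 : measurable (`[0, 1]%classic : set (measurableTypeR R)).
  exact: measurable_itv.
have nu1 : nu m.+1 (`[0, 1]%classic : set (measurableTypeR R)) = 1%E.
  by case: (nuP (ltn0Sn m)).
have nu_lty : (nu m.+1 (`[0%R, 1%R]%classic : set (measurableTypeR R)) < +oo)%E.
  by rewrite nu1 ltry.
rewrite -[leRHS]mulr1 -[X in _ * X]/(fine 1%E) -nu1.
apply: normr_Rintegral_le => //; first exact: resolvent_integrable.
move=> x /=; rewrite in_itv/= => /andP[x0 x1].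
have nx : 2 <= n%:R + x by rewrite (le_trans n2R)// lerDl.
have nx0 : 0 < n%:R + x by rewrite (lt_le_trans _ nx).
rewrite ger0_norm ?invr_ge0 ?exprn_ge0 ?(ltW nx0)// -exprVn exprS.
rewrite (@le_trans _ _ (1 * (n%:R + x)^-1 ^+ m))//.
  rewrite ler_wpM2r ?exprn_ge0 ?invr_ge0 ?(ltW nx0)// invf_le1//.
  by rewrite (le_trans _ nx)// ler1n.
by rewrite mul1r lerXn2r ?nnegrE ?invr_ge0 ?(ltW nx0)// lef_pV2 ?posrE.
Qed.

Section one_measure.
Variable D : set (word b).
Hypothesis DF : D `<=` langF w.
Let mu : {measure set (measurableTypeR R) -> \bar R} := word_measure D.
Let mass := fine (mu I01).

Let mass_ge0 : 0 <= mass. Proof. by rewrite fine_ge0. Qed.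

Let mu_lty : (mu I01 < +oo)%E.
Proof. by have := word_measure_lty R hp DF. Qed.

Let poly_integrable (q : {poly R}) :
  mu.-integrable I01 (EFin \o (fun x : measurableTypeR R => q.[x])).
Proof.
apply: (@bounded_integrable _ _ _ _ (\sum_(0 <= k < size q) `|q`_k|)) => //.
  apply: subspace_continuous_measurable_fun => //.
  apply: continuous_subspaceT => x; exact: continuous_horner.
move=> x /I01_sub; rewrite /= in_itv/= => /andP[x0 x1].
rewrite horner_coef big_mkord (le_trans (ler_norm_sum _ _ _))//; apply: ler_sum => k _.
by rewrite normrM ler_piMr// normrX exprn_ile1// ger0_norm.
Qed.

Lemma Rintegral_eigenpoly_bound : exists2 C : R, 0 <= C &
  forall m, `|\int[mu]_(x in I01) (B m).[x]| <= C * (3 / 2) ^+ m.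
Proof.
have [C C0 BC] := eigenpoly_bounded hp BP.
exists (C * mass) => [|m]; first by rewrite mulr_ge0.
rewrite mulrAC; apply: normr_Rintegral_le => //.
by move=> x /I01_sub; rewrite /= in_itv/=; exact: BC.
Qed.

Let sum_horner (c : nat -> R) N (x : R) :
  \sum_(0 <= m < N) c m * (B m).[x] = (\sum_(0 <= m < N) c m *: B m).[x].
Proof. by rewrite horner_sum; apply: eq_bigr => m _; rewrite hornerZ. Qed.

Let Rintegral_lincomb (c : nat -> R) N :
  \int[mu]_(x in I01) (\sum_(0 <= m < N) c m *: B m).[x] =
  \sum_(0 <= m < N) c m * \int[mu]_(x in I01) (B m).[x].
Proof.
elim: N => [|N IH].
  rewrite !big_geq//; under eq_Rintegral do rewrite horner0.
  by rewrite Rintegral_cst// mul0r.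
rewrite !big_nat_recr//= -IH -RintegralZl// -RintegralD//; last first.
  by under eq_fun do rewrite -hornerZ; exact: poly_integrable.
by apply: eq_Rintegral => x _; rewrite hornerD hornerZ.
Qed.

Lemma Rintegral_resolvent_expansion : exists2 C : R, 0 <= C &
  forall n N : nat, (2 <= n)%N -> (0 < N)%N ->
  `|\int[mu]_(x in I01) (n%:R + x)^-1 -
    \sum_(0 <= m < N) (-1) ^+ m * coefA nu m.+1 n * \int[mu]_(x in I01) (B m).[x]|
  <= C * (4 / 5) ^+ N.
Proof.
have [C C0 expC] := resolvent_expansion hp nuP BP.
exists (C * mass) => [|n N n2 N0]; first by rewrite mulr_ge0.
have nR0 : (0 : R) < n%:R by rewrite ltr0n (leq_trans _ n2).
have resI : mu.-integrable I01 (EFin \o (fun x : measurableTypeR R => (n%:R + x)^-1 : R)).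
  exact: (resolvent_integrable mI01 mu_lty 1 nR0 I01_sub).
rewrite -Rintegral_lincomb -RintegralB// mulrAC.
apply: normr_Rintegral_le => //.
  exact: (integrableB mI01 resI (poly_integrable _)).
move=> x /I01_sub; rewrite /= in_itv/= => x01.
by rewrite -sum_horner; exact: expC.
Qed.

End one_measure.

Let E0 := langF w.
Let muF : {measure set (measurableTypeR R) -> \bar R} := mu0 R w.
Let muR : {measure set (measurableTypeR R) -> \bar R} := eta0 R w.

Let sub_F : E0 `<=` langF w. Proof. by []. Qed.
Let sub_R : langR w `<=` langF w. Proof. exact: langR_sub. Qed.

Variables (s1 s2 : seq nat) (t : nat -> nat).
Hypothesis s1_ge2 : forall a, a \in s1 -> (2 <= a)%N.
Hypothesis s2_ge2 : forall a, a \in s2 -> (2 <= t a)%N.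

(** Applied with [s1] the range $b\le a<b^2$, [s2] the leading digits and [t a] equal to $ab^p$; all
    these numbers are at least 2. *)
Let u (m : nat) : R := (-1) ^+ m *
  (\sum_(a <- s1) coefA nu m.+1 a * \int[muF]_(x in I01) (B m).[x]
   - \sum_(a <- s2) coefA nu m.+1 (t a) * \int[muR]_(x in I01) (B m).[x]).

(** The decay $|A_{m+1}(n)|\le2^{-m}$ outweighs the growth $(3/2)^m$ of the integrals of $B_m$,
    leaving $(3/4)^m$. *)
Lemma u_geometric : geometric_series u.
Proof.
have [C1 C10 C1P] := Rintegral_eigenpoly_bound sub_F.
have [C2 C20 C2P] := Rintegral_eigenpoly_bound sub_R.
have sum_le m (s : seq nat) (tt : nat -> nat) (C I : R) : 0 <= C ->
   (forall a, a \in s -> (2 <= tt a)%N) -> `|I| <= C * (3 / 2) ^+ m ->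
   `|\sum_(a <- s) coefA nu m.+1 (tt a) * I| <= (size s)%:R * (C * (3 / 4) ^+ m).
  move=> C0 s2P IC; apply: norm_sum_seq_le => a /s2P a2.
  rewrite normrM; have -> : C * (3 / 4) ^+ m = 2^-1 ^+ m * (C * (3 / 2) ^+ m).
    by rewrite mulrCA -exprMn; congr (_ * _ ^+ _); field.
  by rewrite ler_pM// coefA_bound.
have u_le m : `|u m| <= ((size s1)%:R * C1 + (size s2)%:R * C2) * (3 / 4) ^+ m.
  rewrite /u normrM normrX normrN1 expr1n mul1r (le_trans (ler_normB _ _))// mulrDl.
  rewrite -!mulrA; apply: lerD; first exact: (sum_le m s1 id C1 _ C10 s1_ge2 (C1P m)).
  exact: (sum_le m s2 t C2 _ C20 s2_ge2 (C2P m)).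
exists (3 / 4); split; [lra|lra|].
(* The added 1 makes the constant strictly positive, as [eqO_exP] requires. *)
apply/eqO_exP; exists (((size s1)%:R * C1 + (size s2)%:R * C2) + 1).
  by rewrite ltr_wpDl// addr_ge0// mulr_ge0.
near=> m; rewrite (le_trans (u_le m))// (ger0_norm (_ : 0 <= (3 / 4) ^+ m)) ?exprn_ge0//.
by rewrite ler_wpM2r ?exprn_ge0// lerDl.
Unshelve. all: by end_near. Qed.

Lemma series_u_cvg : series u @ \oo -->
  (\sum_(a <- s1) \int[muF]_(x in I01) (a%:R + x)^-1
   - \sum_(a <- s2) \int[muR]_(x in I01) ((t a)%:R + x)^-1).
Proof.
have [C1 C10 C1P] := Rintegral_resolvent_expansion sub_F.
have [C2 C20 C2P] := Rintegral_resolvent_expansion sub_R.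
apply: (@cvg_geometric_bound _ _ _ ((size s1)%:R * C1 + (size s2)%:R * C2) (4 / 5)).
  by lra.
move=> N N0.
have -> : series u N =
    \sum_(a <- s1) \sum_(0 <= m < N)
      (-1) ^+ m * coefA nu m.+1 a * \int[muF]_(x in I01) (B m).[x]
    - \sum_(a <- s2) \sum_(0 <= m < N)
      (-1) ^+ m * coefA nu m.+1 (t a) * \int[muR]_(x in I01) (B m).[x].
  rewrite /series /= exchange_big/= [X in _ = _ - X]exchange_big/= -sumrB.
  apply: eq_bigr => m _; rewrite /u mulrBr !mulr_sumr.
  by congr (_ - _); apply: eq_bigr => a _; rewrite mulrA.
have ac (i1 i2 v1 v2 : R) : i1 - i2 - (v1 - v2) = (i1 - v1) - (i2 - v2) by ring.
rewrite ac -!sumrB (le_trans (ler_normB _ _))// mulrDl -!mulrA.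
apply: lerD; apply: norm_sum_seq_le => a.
- by move=> /s1_ge2 a2; exact: C1P.
- by move=> /s2_ge2 a2; exact: C2P.
Qed.

End series_expansion.

                           

(** * Decomposition of the Kempner series by leading digits *)

Lemma big_nat_two_digits (R : Type) (idx : R) (op : Monoid.com_law idx) b (F : nat -> R) :
  \big[op/idx]_(b <= a < b ^ 2) F a =
  \big[op/idx]_(1 <= d < b) \big[op/idx]_(0 <= e < b) F (d * b + e)%N.
Proof.
case: b => [|b]; first by rewrite !big_geq.
suff H k : \big[op/idx]_(b.+1 <= a < k.+1 * b.+1) F a =
  \big[op/idx]_(1 <= d < k.+1) \big[op/idx]_(0 <= e < b.+1) F (d * b.+1 + e)%N.
  by rewrite -H -mulnn.
elim: k => [|k IH]; first by rewrite mul1n !big_geq.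
rewrite [RHS]big_nat_recr//= -IH (@big_cat_nat _ _ _ (k.+1 * b.+1)%N)/=.
- congr (op _ _); rewrite -{1}[(k.+1 * b.+1)%N]add0n big_addn.
  rewrite [(k.+2 * _)%N]mulSn addnK; apply: eq_bigr => e _.
  by rewrite addnC.
- by rewrite leq_pmull.
- by rewrite leq_mul2r leqnSn orbT.
Qed.

Section kempner_series.
Variables (R : realType) (b p : nat) (hb : (1 < b)%N) (hp : (1 <= p)%N).
Let w := zeros hb p.
Implicit Types (d e : 'I_b) (g h : word b).

Let b_gt0 : (0 < b)%N. Proof. exact: ltnW hb. Qed.

Lemma word_val_rcons g d : word_val (rcons g d) = (word_val g * b + d)%N.
Proof. by rewrite /word_val foldl_rcons. Qed.

Lemma word_val_cons d g : word_val (d :: g) = (d * b ^ size g + word_val g)%N.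
Proof. by rewrite -cat1s word_val_cat /= /word_val /= mul0n add0n. Qed.

Let lead_gt0 g : bool := if g is d :: _ then (0 < d)%N else true.

(** Reduction modulo $b$ recovers the last digit; without leading zeros only the empty word has
    value 0, which settles the base cases. *)
Lemma word_val_inj g h : lead_gt0 g -> lead_gt0 h ->
  word_val g = word_val h -> g = h.
Proof.
have val0 f d : lead_gt0 (rcons f d) -> word_val (rcons f d) <> 0%N.
  case: f => [|e f] /= e0.
    by rewrite /word_val /= mul0n add0n => d0; rewrite d0 in e0.
  have : (0 < e * b ^ size (rcons f d))%N by rewrite muln_gt0 e0 expn_gt0 b_gt0.
  by rewrite word_val_cons; lia.
have lead_rcons f d : lead_gt0 (rcons f d) -> lead_gt0 f by case: f.
elim/last_ind: g h => [|g d IH] h; elim/last_ind: h => [|h e _]//.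
- by move=> _ h0 /esym/(val0 _ _ h0).
- by move=> g0 _ /(val0 _ _ g0).
move=> g0 h0; rewrite !word_val_rcons => gh.
have de : d = e.
  apply: val_inj; have := congr1 (modn^~ b) gh.
  by rewrite /= !modnMDl !modn_small.
rewrite de in gh *; congr rcons.
apply: IH; rewrite ?(lead_rcons _ _ g0) ?(lead_rcons _ _ h0)//.
by move/addIn/eqP: gh; rewrite eqn_pmul2r// => /eqP.
Qed.

Lemma occ_lead0 d g : (0 < d)%N -> occ w (d :: g) = occ w g.
Proof. by move=> d0; rewrite occ_cons prefix_zeros_cons// eqn0Ngt d0. Qed.

Lemma word_val_neq0 d g : (0 < d)%N -> (0 < word_val (d :: g))%N.
Proof. by move=> d0; rewrite word_val_cons addn_gt0 muln_gt0 d0 expn_gt0 b_gt0. Qed.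

Let F g : \bar R := ((word_val g)%:R^-1)%:E.

Let F_ge0 g : (0 <= F g)%E. Proof. by rewrite lee_fin invr_ge0. Qed.

Let K : set (word b) :=
  [set g | [/\ g != [::], lead_gt0 g & occ w g = 0%N]].

Lemma kempner_words : kempner R w = (\esum_(g in K) F g)%E.
Proof.
rewrite /kempner (reindex_esum K _ (@word_val b))//; split.
- case=> [|d g]; first by case.
  by case=> _ d0 occ0; split; [exact: word_val_neq0|exists (d :: g)].
- by move=> g h /set_mem[_ g0 _] /set_mem[_ h0 _]; exact: word_val_inj.
- move=> n [n0 [g [gn g0] occ0]]; exists g => //; split=> //.
  by apply: contraTneq n0 => g_nil; rewrite -gn g_nil.
by move: g0; case: (g).
Qed.

(** The sum of $1/n$ over $n=ab^{|g|}+n(g)$ with $g$ in [D], since such an $n$ equals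
    $b^{|g|}(a+x(g))$. *)
Definition digit_tail (a : nat) (D : set (word b)) : \bar R :=
  (\esum_(g in D) (b%:R ^- size g * (a%:R + word_pt R g)^-1)%:E)%E.

(** The tails that may follow the second digit [e]: those for which [e :: g] avoids [w]. A non-zero
    leading digit starts no occurrence. *)
Let J (e : 'I_b) : set (word b) := [set g | langF w g /\ ~~ prefix w (e :: g)].

Let F_two_digits d e g :
  F (d :: e :: g) = (b%:R ^- size g * ((d * b + e)%:R + word_pt R g)^-1)%:E.
Proof.
have bR : (b%:R : R) != 0 by rewrite pnatr_eq0 -lt0n.
rewrite /F !word_val_cons /=; congr _%:E; rewrite -invfM; congr (_^-1).
rewrite mulrDr /word_pt mulrC [_ * (_ / _)]mulrC divfK ?expf_neq0//.
by rewrite -natrX -natrM -natrD expnS; congr _%:R; ring.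
Qed.

Lemma kempner_split : kempner R w =
  (\sum_(d : 'I_b | (0 < d)%N) (d%:R^-1)%:E +
   \sum_(x : 'I_b * 'I_b | (0 < x.1)%N) digit_tail (x.1 * b + x.2) (J x.2))%E.
Proof.
rewrite kempner_words (esumID [set g | size g = 1%N])//; congr (_ + _)%E.
  rewrite -(@esum_finType _ _ (fun d : 'I_b => (0 < d)%N)); last first.
    by move=> d _; rewrite lee_fin invr_ge0.
  rewrite (reindex_esum [set d : 'I_b | (0 < d)%N] _ (fun d => [:: d])).
    by apply: eq_esum => d _; rewrite /F word_val_cons muln1 addn0.
  split.
  - move=> d /= d0; split=> //; split=> //.
    by rewrite occ_lead0.
  - by move=> d e _ _ [].
  - move=> [|d [|e g]] [[]]// _ d0 _ _; first by exists d.
have term_ge0 (a : nat) g :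
    (0 <= (b%:R ^- size g * (a%:R + word_pt R g)^-1 : R)%:E)%E.
  by rewrite lee_fin mulr_ge0 ?word_weight_ge0// invr_ge0 addr_ge0 ?word_pt_ge0.
rewrite -(@esum_finType _ _ (fun x : 'I_b * 'I_b => (0 < x.1)%N)); last first.
  by move=> x _; exact: esum_ge0.
rewrite /digit_tail esum_esum//.
rewrite (reindex_esum ([set x : 'I_b * 'I_b | (0 < x.1)%N] `*`` (fun x => J x.2)) _
  (fun k => k.1.1 :: k.1.2 :: k.2)); last first.
  split.
  - move=> [[d e] g] /= [d0 [gF gp]]; split=> //; split=> //.
    by rewrite occ_lead0// occ_cons (negbTE gp) gF.
  - by move=> [[d e] g] [[d' e'] g'] _ _ /= [-> -> ->].
  - move=> [|d [|e g]] [[]]// _ d0 occ0; first by move=> /(_ erefl).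
    move=> _; exists (d, e, g) => //; split=> //=.
    move: occ0; rewrite occ_lead0// occ_cons => /eqP.
    by rewrite addn_eq0 eqb0 => /andP[gp /eqP gF].
by apply: eq_esum => -[[d e] g] _ /=; rewrite F_two_digits.
Qed.

(** A tail $g\in\mathcal F$ is forbidden after $e$ only if $e=0$ and $g=0^{p-1}h$, with
    $h\in\mathcal R$ by [langRE]. Then $d\,0\,0^{p-1}h$ is $db^p$ followed by $h$, so the forbidden
    terms form a tail sum over $\mathcal R$. *)
Lemma digit_tail_split d e :
  (digit_tail (d * b + e) (langF w) = digit_tail (d * b + e) (J e) +
    if val e == 0%N then digit_tail (d * b ^ p) (langR w) else 0)%E.
Proof.
rewrite /digit_tail (esumID [set g | ~~ prefix w (e :: g)]); last first.
  move=> g _; rewrite lee_fin mulr_ge0 ?word_weight_ge0//.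
  by rewrite invr_ge0 addr_ge0 ?word_pt_ge0.
congr (_ + _)%E; case: eqP => [e0|/eqP e0]; last first.
  rewrite (_ : _ `&` _ = set0) ?esum_set0//; apply/seteqP; split => // g [_ /negP].
  by rewrite negbK prefix_zeros_cons// (negbTE e0).
pose Z := zeros hb p.-1.
rewrite (_ : _ `&` _ = [set Z ++ g | g in langR w]); last first.
  apply/seteqP; split=> [g [gF /negP]|_ [g /(langRE hb hp) gR <-]].
    rewrite negbK prefix_zeros_cons// e0 eqxx => /prefixP[h gE].
    by exists h => //; apply/(langRE hb hp); rewrite -gE.
  split=> //; apply/negP; rewrite negbK prefix_zeros_cons// e0 eqxx.
  exact: prefix_prefix.
rewrite esum_image; last by move=> g h _ _ /eqP; rewrite eqseq_cat// => /andP[_ /eqP].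
apply: eq_esum => g _; congr _%:E.
have Z0 : word_val Z = 0%N.
  by rewrite /Z /zeros; elim: (p.-1) => // k IH; rewrite /= word_val_cons mul0n IH.
have bR : (b%:R : R) != 0 by rewrite pnatr_eq0 -lt0n.
have szZ : size Z = p.-1 by rewrite size_nseq.
rewrite /word_pt word_val_cat Z0 mul0n add0n size_cat szZ e0 addn0.
have -> : (d * b ^ p)%:R = (d * b)%:R * b%:R ^+ p.-1 :> R.
  by rewrite -natrX -natrM -mulnA -expnS prednK.
have mulK n (v : R) : b%:R ^+ n * (v / b%:R ^+ n) = v.
  by rewrite mulrC divfK ?expf_neq0.
rewrite -!invfM !mulrDr !mulK; congr ((_ + _)^-1).
by rewrite exprD [RHS]mulrCA [_ * (d * b)%:R]mulrC mulrA [b%:R ^+ p.-1 * _]mulrC mulrA.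
Qed.

(** The correction stands on the left, which makes this an identity of non-negative extended reals,
    with no subtraction of possibly infinite values. *)
Lemma kempner_digit_tail :
  (kempner R w + \sum_(1 <= a < b) digit_tail (a * b ^ p) (langR w) =
   \sum_(1 <= a < b) (a%:R^-1)%:E + \sum_(b <= a < b ^ 2) digit_tail a (langF w))%E.
Proof.
have ordE (G : nat -> \bar R) :
    (\sum_(1 <= a < b) G a = \sum_(d < b | (0 < d)%N) G d)%E.
  by rewrite big_geq_mkord.
rewrite big_nat_two_digits !ordE kempner_split -addeA; congr (_ + _)%E.
transitivity (\sum_(d < b | (0 < d)%N)
    \sum_(e < b) digit_tail (d * b + e) (langF w))%E; last first.
  by apply: eq_bigr => d _; rewrite big_mkord.
under [RHS]eq_bigr => d _.
  under eq_bigr => e _ do rewrite digit_tail_split.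
  rewrite big_split/=; over.
rewrite big_split/=; congr (_ + _)%E.
  by rewrite pair_big/=; apply: eq_bigl => x; rewrite andbT.
apply: eq_bigr => d _; rewrite (bigD1 (Ordinal b_gt0))//= big1 ?adde0//.
by move=> e e0; rewrite -val_eqE /= in e0; rewrite (negbTE e0).
Qed.

End kempner_series.

Lemma digit_tail_Rintegral (R : realType) (b p : nat) (hb : (1 < b)%N) (hp : (1 <= p)%N)
    (D : set (word b)) (a : nat) : (0 < a)%N -> D `<=` langF (zeros hb p) ->
  digit_tail R a D =
  (\int[word_measure D : {measure set (measurableTypeR R) -> \bar R}]_(x in `[0%R, 1%R[)
     (a%:R + x)^-1)%:E.
Proof.
move=> a0 DF; have aR : (0 : R) < a%:R by rewrite ltr0n.
have mI01 : measurable (`[0, 1[%classic : set (measurableTypeR R)).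
  exact: measurable_itv.
have I01_sub : (`[0, 1[%classic : set (measurableTypeR R)) `<=` `[0, 1]%classic.
  by move=> x; rewrite /= !in_itv/= => /andP[-> /ltW].
have mu_lty := word_measure_lty R hp DF.
have resI := resolvent_integrable mI01 mu_lty 1 aR I01_sub.
rewrite /digit_tail -(word_measure_integral hb D (f := fun x => (a%:R + x)^-1)).
- by rewrite fineK//; exact: integrable_fin_num resI.
- exact: (measurable_resolvent mI01 1 aR I01_sub).
- by move=> x; rewrite /= in_itv/= => /andP[x0 _]; rewrite invr_ge0 addr_ge0.
Qed.

Theorem proposition22 (R : realType) (b p : nat) (hb : (1 < b)%N)
    (hp : (1 <= p)%N)
    (nu : nat -> probability (measurableTypeR R) R) (B : nat -> {poly R})
    (hnu : forall j : nat, (1 <= j)%N -> is_nu (zeros hb p) j (nu j))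
    (hB : forall m : nat, is_B (zeros hb p) m (B m)) :
  let w := zeros hb p in
  let u : R^nat := fun m => (-1) ^+ m *
    (\sum_(b <= a < b ^ 2)
        coefA nu m.+1 a * \int[mu0 R w]_(x in `[0, 1[) (B m).[x]
     - \sum_(1 <= a < b) coefA nu m.+1 (a * b ^ p) * coefR w B m.+1) in
  geometric_series u /\
  kempner R w = (\sum_(1 <= a < b) a%:R^-1 + limn (series u))%:E.
Proof.
move=> w u.
have s1_ge2 a : a \in index_iota b (b ^ 2) -> (2 <= a)%N.
  by rewrite mem_index_iota => /andP[+ _]; exact: leq_trans.
have s2_ge2 a : a \in index_iota 1 b -> (2 <= a * b ^ p)%N.
  rewrite mem_index_iota => /andP[a1 _]; rewrite (leq_trans hb)//.
  by rewrite -[leqLHS]mul1n leq_mul// -{1}[b]expn1 leq_exp2l.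
split; first exact: (u_geometric hp hnu hB s1_ge2 s2_ge2).
have u_lim := series_u_cvg hp hnu hB s1_ge2 s2_ge2.
rewrite (cvg_lim _ u_lim)//.
have := kempner_digit_tail R hb hp.
have -> : (\sum_(1 <= a < b) digit_tail R (a * b ^ p) (langR w) =
    (\sum_(1 <= a < b) \int[eta0 R w]_(x in `[0%R, 1%R[) ((a * b ^ p)%:R + x)^-1)%:E)%E.
  rewrite -sumEFin; apply: eq_big_nat => a /andP[a1 _].
  apply: (@digit_tail_Rintegral R b p hb hp); last exact: langR_sub.
  by rewrite muln_gt0 a1 expn_gt0 (ltnW hb).
have -> : (\sum_(b <= a < b ^ 2) digit_tail R a (langF w) =
    (\sum_(b <= a < b ^ 2) \int[mu0 R w]_(x in `[0%R, 1%R[) (a%:R + x)^-1)%:E)%E.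
  rewrite -sumEFin; apply: eq_big_nat => a /andP[ba _].
  by apply: (@digit_tail_Rintegral R b p hb hp) => //; rewrite (leq_trans _ ba)// ltnW.
(* The correction is now a real number, so it can be moved to the other side. *)
rewrite sumEFin -EFinD => /eqP; rewrite eq_sym -sube_eq ?fin_num_adde_defl// => /eqP<-.
by rewrite -EFinB addrA.
Qed.
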